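(* For every $1<p<\infty$ there exists a Schauder basic sequence $(z_j)_{j=0}^\infty$ in $L_p(\mathbb{R})$ consisting of non-negative functions such that $L_p(\mathbb{R})$ is isomorphic to a subspace of the closed linear span of $(z_j)_{j=0}^\infty$.
   Context: A sequence in a Banach space is a Schauder basic sequence if it is a Schauder basis of its closed linear span. ''Isomorphic'' means linearly isomorphic as Banach spaces (bounded linear bijection with bounded inverse). Non-negative means $\ge0$ almost everywhere. *)

(* Defs.v *)
From HB Require Import structures.
From mathcomp Require Import all_boot all_order all_algebra.
From mathcomp Require Import all_classical all_reals all_analysis.
Set Implicit Arguments. Unset Strict Implicit. Unset Printing Implicit Defensive.
Import Order.TTheory GRing.Theory Num.Theory.
Import numFieldNormedType.Exports.
Local Open Scope classical_set_scope.
Local Open Scope ring_scope.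

(* Elements of L_p(R) are represented by Borel-measurable functions
   f : R -> R with finite p-norm w.r.t. Lebesgue measure; two functions
   represent the same element iff their difference has p-norm 0. *)

Definition Lp (R : realType) (p : R) (f : R -> R) : Prop :=
  measurable_fun setT f /\ finite_norm (@lebesgue_measure R) p%:E f.

Definition Lpnorm (R : realType) (p : R) (f : R -> R) : R :=
  fine ('N[@lebesgue_measure R]_(p%:E)[EFin \o f])%E.

Definition lincomb (R : realType) (z : nat -> R -> R) (a : nat -> R) (n : nat)
  : R -> R := fun x => \sum_(j < n) a j * z j x.

Definition closed_span (R : realType) (p : R) (z : nat -> R -> R)
  : set (R -> R) :=
  [set f | Lp p f /\ forall eps : R, 0 < eps ->
     exists (n : nat) (a : nat -> R), Lpnorm p (f \- lincomb z a n) < eps].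

Definition expands (R : realType) (p : R) (z : nat -> R -> R) (a : nat -> R)
  (f : R -> R) : Prop :=
  (fun n => Lpnorm p (f \- lincomb z a n)) @ \oo --> (0 : R).

Definition schauder_basic (R : realType) (p : R) (z : nat -> R -> R) : Prop :=
  (forall j, Lp p (z j)) /\
  forall f, closed_span p z f ->
    (exists a, expands p z a f) /\
    (forall a b, expands p z a f -> expands p z b f -> a = b).

Definition Lp_embeds_into_span (R : realType) (p : R) (z : nat -> R -> R)
  : Prop :=
  exists (T : (R -> R) -> (R -> R)) (c C : R),
    0 < c /\ 0 < C /\
    (forall f, Lp p f -> closed_span p z (T f)) /\
    (forall (l : R) f g, Lp p f -> Lp p g ->
       Lpnorm p (T (fun x => l * f x + g x) \- (fun x => l * T f x + T g x)) = 0) /\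
    (forall f, Lp p f -> c * Lpnorm p f <= Lpnorm p (T f) /\
                         Lpnorm p (T f) <= C * Lpnorm p f).

(* Main.v *)
Require Import Defs.
From HB Require Import structures.
From mathcomp Require Import all_boot all_order all_algebra.
From mathcomp Require Import all_classical all_reals all_analysis.
From mathcomp Require Import measurable_realfun ring lra zify.
Set Implicit Arguments. Unset Strict Implicit. Unset Printing Implicit Defensive.
Import Order.TTheory GRing.Theory Num.Theory.
Import numFieldNormedType.Exports.
Local Open Scope classical_set_scope.
Local Open Scope ring_scope.

(** Let [h_j] be a normalized Haar system of [L_p(R)] (for an arbitrary dense
    sequence of breakpoints), moved isometrically off [0, 1] by cutting the line
    at [0].  In the freed interval live countably many disjointly supported unit
    vectors.  To each [h_j] is attached a block of non-negative vectors
      [h_j^+ / n + kappa (e_m + sum_i A_im f_i)]   and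
      [(h_j^- + kappa sum_m e_m) / (n L) + kappa f_i],
    listed alternately, where [e_m], [f_i] ([m, i < n]) are fresh unit vectors,
    [kappa = n^(-1/p)] and [A] is a non-negative matrix all of whose row and
    column sums are [L].  The sum of the vectors of the first kind minus [L]
    times the sum of those of the second kind is [h_j], so that the span contains
    a copy of [L_p(R)].
    In a block with coefficients [a], [b] the coefficient of [h_j] is the mean of
    [a], up to the mean of [b + A a] divided by [L]; since [L = L_j] can be taken
    large, these errors are summable, and the [h_j]-coefficients are controlled by
    the norm of the sum.  The deviation of [a] from its mean is seen on the [e_m],
    and [b + A a] is seen on the [f_i].  It remains that cutting a block is
    bounded, i.e. that the parts of [A] separated by a cut of the index set have
    uniformly bounded norm on [l_p] although [L] is large. *)

(** * Real powers and the calculus of the L_p norm *)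

Lemma powR_le_inv (R : realType) (r a b : R) : 0 < r -> 0 <= a -> 0 <= b ->
  a `^ r <= b `^ r -> a <= b.
Proof.
move=> r0 a0 b0; apply: contraTT; rewrite -!ltNge => ba.
by apply: gt0_ltr_powR.
Qed.

Lemma measurable_norm_powR (R : realType) (r : R) (f : R -> R) :
  measurable_fun setT f -> measurable_fun setT (fun x => `|f x| `^ r).
Proof.
move=> mf.
by apply: (@measurableT_comp _ _ _ _ _ _ (@powR R ^~ r)) => //; exact: measurableT_comp.
Qed.

Section LpBasics.
Variables (R : realType) (p : R).
Hypothesis p1 : 1 < p.
Local Notation mu := (@lebesgue_measure R).
Local Notation N := (Lpnorm p).

Let p0 : 0 < p. Proof. exact: lt_trans p1. Qed.
Let pE1 : (1 <= p%:E)%E. Proof. by rewrite lee_fin ltW. Qed.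

Lemma Lp_Lfun (f : R -> R) : Lp p f <-> f \in Lfun mu p%:E.
Proof.
split=> [[mf nf]|]; first by rewrite inE; apply/andP; split; rewrite inE.
by rewrite inE => /andP[]; rewrite !inE.
Qed.

Lemma LpnormE (f : R -> R) : Lp p f ->
  (N f)%:E = ('N[mu]_(p%:E)[EFin \o f])%E.
Proof. by move=> [_ nf]; rewrite /Lpnorm fineK// ge0_fin_numE ?Lnorm_ge0. Qed.

Lemma Lpnorm_ge0 (f : R -> R) : 0 <= N f.
Proof. exact/fine_ge0/Lnorm_ge0. Qed.

Lemma Lp0 : Lp p (fun=> 0).
Proof. by split=> //; exact: finite_norm_cst0. Qed.

Lemma LpD (f g : R -> R) : Lp p f -> Lp p g -> Lp p (fun x => f x + g x).
Proof.
by move=> /Lp_Lfun lf /Lp_Lfun lg; apply/Lp_Lfun; have [_] := Lfun_addr_closed mu pE1; apply.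
Qed.

Lemma LpZ (a : R) (f : R -> R) : Lp p f -> Lp p (fun x => a * f x).
Proof.
move=> /Lp_Lfun lf; apply/Lp_Lfun.
rewrite (_ : (fun x => a * f x) = (a \o* f)); first exact: Lfun_scale (ltW p1) lf.
by apply/funext => x /=; rewrite mulrC.
Qed.

Lemma LpN (f : R -> R) : Lp p f -> Lp p (fun x => - f x).
Proof.
by move=> /(LpZ (-1)); under eq_fun do rewrite mulN1r.
Qed.

Lemma LpB (f g : R -> R) : Lp p f -> Lp p g -> Lp p (fun x => f x - g x).
Proof. by move=> lf lg; apply: LpD => //; exact: LpN. Qed.

Lemma Lp_sum (I : Type) (r : seq I) (P : pred I) (F : I -> R -> R) :
  (forall i, P i -> Lp p (F i)) -> Lp p (fun x => \sum_(i <- r | P i) F i x).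
Proof.
move=> lF; elim: r => [|i r ih].
  by under eq_fun do rewrite big_nil; exact: Lp0.
under eq_fun do rewrite big_cons.
case: (boolP (P i)) => Pi; last exact: ih.
by apply: LpD => //; exact: lF.
Qed.

Lemma LpnormD (f g : R -> R) : Lp p f -> Lp p g ->
  N (fun x => f x + g x) <= N f + N g.
Proof.
move=> lf lg; rewrite -lee_fin EFinD !LpnormE//; last exact: LpD.
by apply: minkowski_EFin; rewrite ?ltW//; [case: lf|case: lg].
Qed.

Lemma LpnormZ (a : R) (f : R -> R) : Lp p f -> N (fun x => a * f x) = `|a| * N f.
Proof.
move=> lf; apply: EFin_inj; rewrite EFinM !LpnormE//; last exact: LpZ.
have lf' := lf; move: lf' => /Lp_Lfun fL.
have := LnormZ (Lfun_Sub pE1 fL) a.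
by rewrite Lfun_valP.
Qed.

Lemma Lpnorm0 : N (fun=> 0) = 0.
Proof.
rewrite (_ : (fun=> 0) = fun x : R => 0 * (0 : R)); last by apply/funext => x; rewrite mul0r.
by rewrite LpnormZ ?normr0 ?mul0r//; exact: Lp0.
Qed.

Lemma LpnormN (f : R -> R) : Lp p f -> N (fun x => - f x) = N f.
Proof.
move=> lf; rewrite -[RHS]mul1r -[X in X * _]normr1 -normrN -LpnormZ//.
by congr (N _); apply/funext => x; rewrite mulN1r.
Qed.

Lemma LpnormB (f g : R -> R) : Lp p f -> Lp p g ->
  N (fun x => f x - g x) <= N f + N g.
Proof.
by move=> lf lg; rewrite -(LpnormN lg); apply: LpnormD => //; exact: LpN.
Qed.

Lemma Lpnorm_distC (f g : R -> R) : Lp p f -> Lp p g ->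
  N (fun x => f x - g x) = N (fun x => g x - f x).
Proof.
move=> lf lg; rewrite -LpnormN; last exact: LpB.
by congr (N _); apply/funext => x; rewrite opprB.
Qed.

Lemma Lpnorm_sum (I : Type) (r : seq I) (P : pred I) (F : I -> R -> R) :
  (forall i, P i -> Lp p (F i)) ->
  N (fun x => \sum_(i <- r | P i) F i x) <= \sum_(i <- r | P i) N (F i).
Proof.
move=> lF; elim: r => [|i r ih].
  by under eq_fun do rewrite big_nil; rewrite big_nil Lpnorm0.
under eq_fun do rewrite big_cons.
rewrite big_cons; case: (boolP (P i)) => Pi; last exact: ih.
by rewrite (le_trans (LpnormD _ _)) ?lerD2l//; [exact: lF|exact: Lp_sum].
Qed.

Lemma LpnormXE (f : R -> R) : Lp p f ->
  ((N f `^ p)%:E = \int[mu]_x (`|f x| `^ p)%:E)%E.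
Proof.
move=> lf; rewrite -poweR_EFin LpnormE// poweR_Lnorm ?gt_eqF//.
Qed.

Lemma Lp_intP (f : R -> R) : measurable_fun setT f ->
  (\int[mu]_x (`|f x| `^ p)%:E < +oo)%E -> Lp p f.
Proof.
move=> mf intf; split=> //; rewrite /finite_norm unlock /Lnorm.
by apply: poweR_lty; under eq_integral do rewrite /= ; exact: intf.
Qed.

Lemma Lp_int_lty (f : R -> R) : Lp p f ->
  (\int[mu]_x (`|f x| `^ p)%:E < +oo)%E.
Proof. by move=> /LpnormXE <-; rewrite ltry. Qed.

Lemma Lp_le (f g : R -> R) : measurable_fun setT f -> Lp p g ->
  (forall x, `|f x| <= `|g x|) -> Lp p f.
Proof.
move=> mf lg fg; apply: Lp_intP => //.
apply: le_lt_trans (Lp_int_lty lg).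
have mg : measurable_fun setT g by case: lg.
apply: ge0_le_integral => //.
- by apply/measurable_EFinP; apply: measurable_norm_powR.
- by apply/measurable_EFinP; apply: measurable_norm_powR.
- by move=> x _; rewrite lee_fin ge0_ler_powR// ltW.
Qed.

Lemma Lpnorm_le (f g : R -> R) : measurable_fun setT f -> Lp p g ->
  (forall x, `|f x| <= `|g x|) -> N f <= N g.
Proof.
move=> mf lg fg; have lf := Lp_le mf lg fg.
apply: (powR_le_inv p0); rewrite ?Lpnorm_ge0//.
rewrite -lee_fin !LpnormXE//.
have mg : measurable_fun setT g by case: lg.
apply: ge0_le_integral => //.
- by apply/measurable_EFinP; apply: measurable_norm_powR.
- by apply/measurable_EFinP; apply: measurable_norm_powR.
- by move=> x _; rewrite lee_fin ge0_ler_powR// ltW.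
Qed.

End LpBasics.

(** * Convexity of [|x|^p] *)

Lemma powR_pred_mul (R : realType) (p c : R) : 0 < p -> 0 <= c ->
  c `^ (p - 1) * c = c `^ p.
Proof.
move=> p0 c0; have [->|cn0] := eqVneq c 0; first by rewrite mulr0 powR0// gt_eqF.
by rewrite -[X in _ * X]powRr1// -powRD ?subrK// cn0 implybT.
Qed.

Lemma powR_tangent (R : realType) (p c x : R) : 1 < p -> 0 <= c ->
  c `^ p + p * c `^ (p - 1) * (x - c) <= `|x| `^ p.
Proof.
move=> p1 c0; have p0 : 0 < p by exact: lt_trans p1.
have pm : 0 < p - 1 by rewrite subr_gt0.
have q0 : 0 < p / (p - 1) by rewrite divr_gt0.
(* Young's inequality for [|x|] and [c `^ (p - 1)]. *)
have := @conjugate_powR R `|x| (c `^ (p - 1)) p (p / (p - 1)) (normr_ge0 _) (powR_ge0 _ _) p0 q0.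
have -> : p^-1 + (p / (p - 1))^-1 = 1 by field; rewrite !gt_eqF.
move=> /(_ erefl); rewrite -powRrM.
have -> : (p - 1) * (p / (p - 1)) = p by field; rewrite gt_eqF.
rewrite -(ler_pM2l p0).
have -> : p * (`|x| `^ p / p + c `^ p / (p / (p - 1))) = `|x| `^ p + c `^ p * (p - 1).
  by field; rewrite !gt_eqF.
move=> h.
have e := powR_pred_mul p0 c0.
have xx : p * c `^ (p - 1) * x <= p * c `^ (p - 1) * `|x|.
  by rewrite ler_wpM2l ?ler_norm// mulr_ge0 ?powR_ge0// ltW.
rewrite mulrBr -[p * _ * c]mulrA e; move: h xx; clear; lra.
Qed.

(** For [c < 0] the tangent inequality is applied at [- c] to [- x], which changes the sign of the
    slope. Only the existence of a slope is kept, since it cancels in [split_interval_le]. *)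
Lemma normr_powR_subgradient (R : realType) (p c : R) : 1 < p ->
  exists g, forall x, `|c| `^ p + g * (x - c) <= `|x| `^ p.
Proof.
move=> p1; have [c0|c0] := leP 0 c.
  by exists (p * c `^ (p - 1)) => x; rewrite ger0_norm// powR_tangent.
exists (- (p * (- c) `^ (p - 1))) => x.
have Nc0 : 0 <= - c by rewrite oppr_ge0 ltW.
have := powR_tangent (- x) p1 Nc0; rewrite normrN (ltr0_norm c0).
by apply: le_trans; rewrite lerD2l; set A := p * _; rewrite (_ : A * _ = - A * (x - c))//; ring.
Qed.

Lemma cvg_powR_norm0 (R : realType) (p : R) (u : nat -> R) : 0 < p ->
  u @ \oo --> 0 -> (fun n => `|u n| `^ p) @ \oo --> 0.
Proof.
move=> p0 u0; apply/cvgrPdist_lt => e e0.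
have d0 : 0 < e `^ p^-1 by rewrite powR_gt0.
near=> n.
rewrite sub0r normrN ger0_norm ?powR_ge0//.
rewrite -[ltRHS]powRr1 ?ltW// -(mulVf (lt0r_neq0 p0)) powRrM.
rewrite gt0_ltr_powR ?nnegrE ?powR_ge0//.
rewrite -normrN -sub0r; near: n.
by move: u0 => /cvgrPdist_lt; apply.
Unshelve. all: by end_near.
Qed.

Lemma cvg_powR0_inv (R : realType) (p : R) (u : nat -> R) : 0 < p ->
  (forall n, 0 <= u n) -> (fun n => u n `^ p) @ \oo --> 0 -> u @ \oo --> 0.
Proof.
move=> p0 u_ge0 u0; apply/cvgrPdist_lt => e e0.
have d0 : 0 < e `^ p by rewrite powR_gt0.
near=> n.
rewrite sub0r normrN ger0_norm// ltNge; apply/negP => eu.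
suff : u n `^ p < e `^ p by rewrite ltNge ge0_ler_powR ?nnegrE// ltW.
rewrite -[ltLHS]ger0_norm ?powR_ge0// -normrN -sub0r; near: n.
by move: u0 => /cvgrPdist_lt; apply.
Unshelve. all: by end_near.
Qed.

(** * Disjointly supported functions and dominated convergence in L_p *)

Section LpDisjoint.
Variables (R : realType) (p : R).
Hypothesis p1 : 1 < p.
Local Notation mu := (@lebesgue_measure R).
Local Notation N := (Lpnorm p).

Let p0 : 0 < p. Proof. exact: lt_trans p1. Qed.

Lemma LpnormX_disjoint (f g : R -> R) : Lp p f -> Lp p g ->
  (forall x, f x * g x = 0) ->
  N (fun x => f x + g x) `^ p = N f `^ p + N g `^ p.
Proof.
move=> lf lg fg; apply: EFin_inj; rewrite EFinD !LpnormXE//; last exact: LpD.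
have mf : measurable_fun setT f by case: lf.
have mg : measurable_fun setT g by case: lg.
rewrite -ge0_integralD//=.
- apply: eq_integral => x _; rewrite -EFinD; congr EFin.
  have /eqP := fg x; rewrite mulf_eq0 => /orP[]/eqP ->.
    by rewrite normr0 powR0 ?add0r// gt_eqF.
  by rewrite normr0 powR0 ?addr0// gt_eqF.
- by apply/measurable_EFinP; apply: measurable_norm_powR.
- by apply/measurable_EFinP; apply: measurable_norm_powR.
Qed.

Lemma Lpnorm_disjoint_le (f g : R -> R) : Lp p f -> Lp p g ->
  (forall x, f x * g x = 0) -> N f <= N (fun x => f x + g x).
Proof.
move=> lf lg fg; apply: (powR_le_inv p0); rewrite ?Lpnorm_ge0//.
by rewrite LpnormX_disjoint// lerDl powR_ge0.
Qed.

Lemma LpnormX_indic (c : R) (A : set R) : measurable A -> (mu A < +oo)%E ->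
  Lp p (fun x => c * \1_A x) /\
  N (fun x => c * \1_A x) `^ p = `|c| `^ p * fine (mu A).
Proof.
move=> mA Aoo.
have mf : measurable_fun setT (fun x => c * \1_A x : R).
  by apply: measurable_funM => //; exact: measurable_indic.
have E : (\int[mu]_x (`|c * \1_A x| `^ p)%:E = (`|c| `^ p * fine (mu A))%:E)%E.
  rewrite EFinM fineK ?ge0_fin_numE//.
  rewrite -(setIT A) -integral_indic// -ge0_integralZl//.
  - apply: eq_integral => x _; rewrite -EFinM; congr EFin.
    rewrite setIT !indicE; case: (x \in A) => /=; first by rewrite !mulr1.
    by rewrite !mulr0 normr0 powR0// gt_eqF.
  - by apply/measurable_EFinP; exact: measurable_indic.
have lf : Lp p (fun x => c * \1_A x) by apply: Lp_intP => //; rewrite E ltry.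
by split=> //; apply: EFin_inj; rewrite LpnormXE.
Qed.

Lemma Lpnorm_dominated_cvg (f_ : nat -> R -> R) (f g : R -> R) :
  (forall n, measurable_fun setT (f_ n)) -> Lp p f -> Lp p g ->
  (forall x, f_ ^~ x @ \oo --> f x) ->
  (forall n x, `|f_ n x - f x| <= `|g x|) ->
  N (fun x => f_ n x - f x) @[n --> \oo] --> 0.
Proof.
move=> mf_ lf lg f_f fg.
have mf : measurable_fun setT f by case: lf.
have mg : measurable_fun setT g by case: lg.
have mB n : measurable_fun setT (fun x => f_ n x - f x) by exact: measurable_funB.
have lB n : Lp p (fun x => f_ n x - f x) by exact: (Lp_le p1 (mB n) lg).
have mp n : measurable_fun setT (fun x => (`|f_ n x - f x| `^ p)%:E).
  by apply/measurable_EFinP; exact: (measurable_norm_powR p (mB n)).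
have h0 : {ae mu, forall x, setT x -> (fun n => (`|f_ n x - f x| `^ p)%:E) @ \oo --> 0%E}.
  apply: aeW => x _; apply/fine_cvgP; split; first exact: nearW.
  apply: cvg_powR_norm0 => //.
  by apply/subr_cvg0; exact: f_f.
have ig : mu.-integrable setT (fun x => (`|g x| `^ p)%:E).
  apply/integrableP; split; first by apply/measurable_EFinP; apply: measurable_norm_powR.
  under eq_integral do rewrite gee0_abs ?lee_fin ?powR_ge0//.
  exact: Lp_int_lty.
have hd : {ae mu, forall x, forall n, setT x ->
    (`|(`|f_ n x - f x| `^ p)%:E| <= (`|g x| `^ p)%:E)%E}.
  apply: aeW => x n _ /=; rewrite ger0_norm ?powR_ge0// lee_fin.
  by rewrite ge0_ler_powR// ltW.
have [_ + _] := @dominated_convergence _ _ R mu setT measurableT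
  (fun n x => (`|f_ n x - f x| `^ p)%:E) (cst 0%E) (fun x => (`|g x| `^ p)%:E)
  mp (measurable_cst 0%E) h0 ig hd.
rewrite (_ : (fun n => _) = (fun n => (N (fun x => f_ n x - f x) `^ p)%:E)); last first.
  apply/funext => n; rewrite LpnormXE//; apply: eq_integral => x _.
  by rewrite sube0 gee0_abs// lee_fin powR_ge0.
move=> /fine_cvgP[_]; by apply: (cvg_powR0_inv p0) => n; exact: Lpnorm_ge0.
Qed.

End LpDisjoint.

(** * Grunblum's criterion for basic sequences *)

Lemma eqP_le (R : realType) (x y : R) : x = y -> x <= y.
Proof. by move=> ->. Qed.

Lemma le_addV_le (R : realType) (x A B : R) :
  (forall l : nat, x <= A + B * l.+1%:R^-1) -> x <= A.
Proof.
move=> h; apply/ler_addgt0Pr => e e0.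
have [B0|B0] := leP B 0.
  apply: le_trans (h 0) _; rewrite lerD2l invr1 mulr1 (le_trans B0)//; exact: ltW.
have k_lt := truncnS_gt (B / e).
apply: le_trans (h (Num.truncn (B / e))) _.
by rewrite lerD2l ler_pdivrMr// mulrC -ler_pdivrMr// ltW.
Qed.

(** The intervals of centre [x k] and radius [r k] meet pairwise, so each right end bounds all left
    ends, and the supremum of the left ends lies in every interval. This yields limits of
    coefficients together with their rate. *)
Lemma common_limit (R : realType) (x r : nat -> R) :
  (forall k l, `|x k - x l| <= r k + r l) ->
  exists a, forall k, `|x k - a| <= r k.
Proof.
move=> h; pose S := range (fun k => x k - r k).
have ub k : ubound S (x k + r k).
  move=> _ [l _ <-]; have := h l k; rewrite ler_norml => /andP[_]; lra.
have hS : has_sup S.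
  by split; [exists (x 0%N - r 0%N), 0%N|exists (x 0%N + r 0%N); exact: ub].
exists (sup S) => k.
have h1 : x k - r k <= sup S by apply: ub_le_sup; [case: hS|exists k].
have h2 : sup S <= x k + r k by apply: ge_sup; [case: hS|exact: ub].
by rewrite ler_norml; apply/andP; split; lra.
Qed.

Section Lincomb.
Variables (R : realType) (z : nat -> R -> R).

Lemma lincombB (a b : nat -> R) n x :
  lincomb z a n x - lincomb z b n x = lincomb z (fun j => a j - b j) n x.
Proof. by rewrite /lincomb -sumrB; apply: eq_bigr => i _; rewrite mulrBl. Qed.

Lemma lincombS (a : nat -> R) n x :
  lincomb z a n.+1 x = lincomb z a n x + a n * z n x.
Proof. by rewrite /lincomb big_ord_recr. Qed.

Lemma lincomb_pad (a : nat -> R) n m : (n <= m)%N ->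
  lincomb z (fun j => if (j < n)%N then a j else 0) m = lincomb z a n.
Proof.
move=> nm; apply/funext => x; rewrite /lincomb.
rewrite (big_ord_widen _ (fun j => a j * z j x) nm) [RHS]big_mkcond/=.
by apply: eq_bigr => i _; case: ifP => //; rewrite mul0r.
Qed.

End Lincomb.

Section Grunblum.
Variables (R : realType) (p : R).
Hypothesis p1 : 1 < p.
Local Notation N := (Lpnorm p).
Variables (z : nat -> R -> R) (K : R).
Hypothesis zLp : forall j, Lp p (z j).

Lemma Lp_lincomb (a : nat -> R) n : Lp p (lincomb z a n).
Proof. by apply: (Lp_sum p1) => i _; exact: (LpZ p1). Qed.

Lemma Lpnorm_lincomb_le (a : nat -> R) n :
  N (lincomb z a n) <= \sum_(j < n) `|a j| * N (z j).
Proof.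
have := @Lpnorm_sum _ _ p1 _ (index_enum 'I_n) xpredT (fun i x => a i * z i x).
move=> /(_ (fun i _ => LpZ p1 (a i) (zLp i))) /le_trans; apply.
by apply: ler_sum => i _; rewrite (LpnormZ p1).
Qed.

Hypothesis z_neq0 : forall j, N (z j) != 0.
Hypothesis K0 : 0 <= K.
Hypothesis zK : forall a m n, (m <= n)%N ->
  N (lincomb z a m) <= K * N (lincomb z a n).

Let zgt0 j : 0 < N (z j). Proof. by rewrite lt_neqAle eq_sym z_neq0 Lpnorm_ge0. Qed.

(** A term is the difference of two consecutive partial sums, each at most [K] times the whole. *)
Lemma lincomb_coef_le (a : nat -> R) j n : (j < n)%N ->
  `|a j| * N (z j) <= 2 * K * N (lincomb z a n).
Proof.
move=> jn; rewrite -(LpnormZ p1)//.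
rewrite (_ : (fun x => a j * z j x) =
  (fun x => lincomb z a j.+1 x - lincomb z a j x)); last first.
  by apply/funext => x; rewrite lincombS; ring.
apply: le_trans (LpnormB p1 (Lp_lincomb _ _) (Lp_lincomb _ _)) _.
rewrite -mulrA mulrDl mul1r lerD// zK//; exact: ltnW.
Qed.

(** The coefficients of finite combinations approximating [f] converge one by one, because the
    coefficient functionals are bounded. The uniform bound [K] on partial sums then carries the
    approximation over to the limit coefficients. *)
Lemma expands_exists f : closed_span p z f -> exists a, expands p z a f.
Proof.
move=> [fLp fspan].
have /choice[nc ncP] : forall k : nat, exists nc : nat * (nat -> R),
    N (f \- lincomb z nc.2 nc.1) < k.+1%:R^-1.
  by move=> k; have [|n [a na]] := fspan k.+1%:R^-1; [rewrite invr_gt0|exists (n, a)].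
(* Padding by zeros allows approximants of different lengths to be compared at any common length. *)
pose d k j := if (j < (nc k).1)%N then (nc k).2 j else 0.
pose e k : R := k.+1%:R^-1.
have e0 k : 0 <= e k by rewrite invr_ge0.
have dP k m : ((nc k).1 <= m)%N -> N (fun x => f x - lincomb z (d k) m x) <= e k.
  by move=> km; rewrite lincomb_pad//; exact/ltW/ncP.
have dD k l n : N (lincomb z (fun j => d k j - d l j) n) <= K * (e k + e l).
  pose M := (n + (nc k).1 + (nc l).1)%N.
  have nM : (n <= M)%N by rewrite /M; lia.
  apply: le_trans (zK _ nM) _; rewrite ler_wpM2l//.
  rewrite (_ : lincomb _ _ _ = fun x =>
      (f x - lincomb z (d l) M x) - (f x - lincomb z (d k) M x)); last first.
    by apply/funext => x; rewrite -lincombB; ring.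
  apply: le_trans (LpnormB p1 _ _) _; rewrite ?(addrC (e k));
    [exact: (LpB p1 fLp (Lp_lincomb _ _))..|].
  by apply: lerD; apply: dP; rewrite /M; lia.
have /choice[a aP] : forall j, exists aj, forall k,
    `|d k j - aj| <= 2 * K * (K * e k) / N (z j).
  move=> j; apply: common_limit => k l.
  rewrite -mulrDl ler_pdivlMr//.
  apply: le_trans (lincomb_coef_le (fun j => d k j - d l j) (ltnSn j)) _.
  by rewrite -2!mulrDr ler_wpM2l ?mulr_ge0// dD.
exists a.
(* Pass through [d l]: for fixed [n] the part with [d l - a] has [n] terms, each at most
   [2 * K * (K * e l)], and it vanishes as [l] grows. *)
have adP k n : N (lincomb z (fun j => d k j - a j) n) <= K * e k.
  apply: (@le_addV_le _ _ _ (K + n%:R * (2 * K * K))) => l.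
  rewrite (_ : lincomb _ _ _ = fun x => lincomb z (fun j => d k j - d l j) n x +
     lincomb z (fun j => d l j - a j) n x); last first.
    by apply/funext => x; rewrite -!lincombB; ring.
  apply: le_trans (LpnormD p1 (Lp_lincomb _ _) (Lp_lincomb _ _)) _.
  rewrite mulrDl addrA lerD//; first by apply: le_trans (dD _ _ _) _; rewrite mulrDr.
  apply: le_trans (Lpnorm_lincomb_le _ _) _.
  apply: (@le_trans _ _ (\sum_(i < n) 2 * K * (K * e l))).
    by apply: ler_sum => i _; rewrite -ler_pdivlMr.
  by rewrite sumr_const card_ord -mulr_natl -/(e l); set x := e l; apply/eqP_le; ring.
rewrite /expands; apply/cvgrPdist_lt => eps eps0.
(* The total error is [e k] from the approximant plus [K * e k] from changing its coefficients to
   [a]. *)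
pose k := Num.truncn ((1 + K) / eps).
have ke : e k + K * e k < eps.
  rewrite -{1}[e k]mul1r -mulrDl ltr_pdivrMr// mulrC -ltr_pdivrMr//.
  exact: truncnS_gt.
near=> n.
have kn : ((nc k).1 <= n)%N by near: n; exists (nc k).1.
rewrite sub0r normrN ger0_norm ?Lpnorm_ge0//.
rewrite (_ : _ \- _ = fun x => (f x - lincomb z (d k) n x) +
    lincomb z (fun j => d k j - a j) n x); last first.
  by apply/funext => x /=; rewrite -lincombB; ring.
apply: le_lt_trans (LpnormD p1 (LpB p1 fLp (Lp_lincomb _ _)) (Lp_lincomb _ _)) _.
exact: le_lt_trans (lerD (dP _ _ kn) (adP _ _)) ke.
Unshelve. all: by end_near.
Qed.

Lemma expands_unique f a b : Lp p f -> expands p z a f -> expands p z b f -> a = b.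
Proof.
move=> fLp fa fb; apply/funext => j; apply/eqP; rewrite -subr_eq0 -normr_eq0.
suff : `|a j - b j| * N (z j) <= 0.
  by rewrite pmulr_lle0// normr_le0 normr_eq0.
have : (fun n => 2 * K * (N (f \- lincomb z a n) + N (f \- lincomb z b n))) @ \oo
    --> 2 * K * (0 + 0).
  by apply: cvgM; [exact: cvg_cst|exact: cvgD].
rewrite addr0 mulr0; move=> /cvgr_to_ge; apply.
near=> n.
have jn : (j < n)%N by near: n; exists j.+1.
apply: le_trans (lincomb_coef_le (fun j => a j - b j) jn) _.
rewrite ler_wpM2l ?mulr_ge0//.
rewrite (_ : lincomb _ _ _ = fun x =>
    (f x - lincomb z b n x) - (f x - lincomb z a n x)); last first.
  by apply/funext => x; rewrite -lincombB; ring.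
rewrite [leRHS]addrC.
by apply: LpnormB; rewrite //; exact: (LpB p1 fLp (Lp_lincomb _ _)).
Unshelve. all: by end_near.
Qed.

Lemma schauder_basic_grunblum : schauder_basic p z.
Proof.
split=> // f fspan; split; first exact: expands_exists.
by move=> a b; apply: expands_unique; case: fspan.
Qed.

End Grunblum.

(** * Non-negative matrices with large constant row sums and small cut parts *)

Lemma count_divn_eq (d e k : nat) : (0 < d)%N ->
  (\sum_(n < e * d) (n %/ d == k) = (k < e) * d)%N.
Proof.
move=> d0; elim: e => [|e ih]; first by rewrite mul0n big_ord0.
rewrite mulSn addnC big_split_ord/= ih.
rewrite (eq_bigr (fun=> (e == k : nat))); last first.
  by move=> i _; rewrite divnMDl// divn_small// addn0.
rewrite sum_nat_const card_ord ltnS (eq_sym e).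
by case: (ltngtP k e) => //= _; lia.
Qed.

Section Jensen.
Variables (R : realType) (p : R).
Hypothesis p1 : 1 < p.

Let p0 : 0 < p. Proof. exact: lt_trans p1. Qed.

(** Jensen's inequality, by averaging the tangent inequality at the weighted sum [c]. If the total
    weight is [th], the average of the tangents is [c^p] plus [(1 - th) (p - 1) c^p], so missing
    mass only helps. *)
Lemma powR_sum_le (n : nat) (v x : nat -> R) : (forall j, 0 <= v j) ->
  \sum_(j < n) v j <= 1 ->
  (\sum_(j < n) v j * `|x j|) `^ p <= \sum_(j < n) v j * `|x j| `^ p.
Proof.
move=> v0 v1.
have E (X Y c : R) : \sum_(j < n) v j * (X + Y * (`|x j| - c)) =
    (\sum_(j < n) v j) * (X - Y * c) + Y * \sum_(j < n) v j * `|x j|.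
  rewrite mulr_sumr mulr_suml -big_split/=.
  by apply: eq_bigr => j _; ring.
set c := \sum_(j < n) _; set th := \sum_(j < n) v j in v1 *.
have c0 : 0 <= c by apply: sumr_ge0 => j _; rewrite mulr_ge0.
have e := powR_pred_mul p0 c0.
have : \sum_(j < n) v j * (c `^ p + p * c `^ (p - 1) * (`|x j| - c)) <=
    \sum_(j < n) v j * `|x j| `^ p.
  apply: ler_sum => j _; rewrite ler_wpM2l//.
  by have := @powR_tangent R p c `|x j| p1 c0; rewrite normr_id.
apply: le_trans.
rewrite E -/th -/c.
rewrite -[X in _ - X]mulrA -[X in _ + X]mulrA e.
have : 0 <= (1 - th) * ((p - 1) * c `^ p).
  by rewrite !mulr_ge0 ?powR_ge0// ?subr_ge0// ltW.
by lra.
Qed.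

End Jensen.

Section BlockMatrix.
Variables (R : realType) (p : R).
Hypothesis p1 : 1 < p.

Let p0 : 0 < p. Proof. exact: lt_trans p1. Qed.

(** If [l] is the first index with [P l], the geometric sum is at most [2 q^l], and the [p]-th power
    of this is [2^p] times the first non-zero term on the right. The induction strips the leading
    indices where [P] fails. *)
Lemma geometric_powR_le (q : R) (P : nat -> bool) (m : nat) :
  0 <= q -> q <= 2^-1 ->
  (\sum_(l < m) (P l)%:R * q ^+ l) `^ p <=
    2 `^ p * \sum_(l < m) (P l)%:R * (q `^ p) ^+ l.
Proof.
move=> q0 q2; elim: m P => [|m ih] P.
  by rewrite !big_ord0 powR0 ?mulr0// gt_eqF.
rewrite !big_ord_recl !expr0 !mulr1.
have sum_ge0 (x : R) k : 0 <= x -> 0 <= \sum_(l < k) (P l.+1)%:R * x ^+ l.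
  by move=> x0; apply: sumr_ge0 => l _; rewrite mulr_ge0// exprn_ge0.
have E (x : R) : \sum_(i < m) (P (lift ord0 i))%:R * x ^+ lift ord0 i =
    x * \sum_(i < m) (P i.+1)%:R * x ^+ i.
  by rewrite mulr_sumr; apply: eq_bigr => i _; rewrite lift0 exprS mulrCA.
rewrite !E; case: (P 0%N) => /=; rewrite ?mulr0n ?mulr1n; last first.
  rewrite !add0r powRM ?sum_ge0// mulrCA ler_wpM2l ?powR_ge0//.
  exact: (ih (fun l => P l.+1)).
have S2 : \sum_(i < m) (P i.+1)%:R * q ^+ i <= 2.
  have : forall k, \sum_(i < k) (P i.+1)%:R * q ^+ i <= 2 - 2 * q ^+ k.
    elim=> [|k ihk]; first by rewrite big_ord0 expr0 mulr1 subrr.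
    rewrite big_ord_recr/=.
    have qk : 0 <= q ^+ k by rewrite exprn_ge0.
    have : (P k.+1)%:R * q ^+ k <= q ^+ k by case: (P k.+1); rewrite ?mul1r ?mul0r.
    have : q * q ^+ k <= 2^-1 * q ^+ k by rewrite ler_wpM2r.
    rewrite exprS; move: ihk; clear.
    set s := \sum_(_ < _) _; set u := (P _)%:R * _; set t := q ^+ k; lra.
  move=> /(_ m) /le_trans; apply; rewrite gerBl mulr_ge0// exprn_ge0//.
apply: (@le_trans _ _ (2 `^ p)).
  apply: ge0_ler_powR; rewrite ?nnegrE ?(ltW p0)//.
    by rewrite addr_ge0// mulr_ge0 ?sum_ge0.
  have : q * \sum_(i < m) (P i.+1)%:R * q ^+ i <= 2^-1 * 2 by rewrite ler_pM ?sum_ge0.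
  by rewrite mulVf// => h; rewrite [leRHS](_ : 2 = 1 + 1)// lerD2l.
by rewrite ler_peMr ?powR_ge0// lerDl mulr_ge0 ?powR_ge0// sum_ge0 ?powR_ge0.
Qed.

(** Divided by [r ^ l], this is the matrix of the conditional expectation on the [r]-adic blocks of
    length [r ^ l]. *)
Let E (r l i j : nat) : R := (i %/ r ^ l == j %/ r ^ l)%N%:R.

Let E_ge0 r l i j : 0 <= E r l i j. Proof. by rewrite ler0n. Qed.

Let E_sum r l m j : (0 < r)%N ->
  \sum_(i < r ^ (m + l)) E r l i j = ((j %/ r ^ l < r ^ m)%N * r ^ l)%N%:R.
Proof.
move=> r0; rewrite expnD -count_divn_eq ?expn_gt0 ?r0//.
by rewrite natr_sum; apply: eq_bigr.
Qed.

Let E_sum_lt r m l j : (0 < r)%N -> (l < m)%N -> (j < r ^ m)%N ->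
  \sum_(i < r ^ m) E r l i j = (r ^ l)%:R.
Proof.
move=> r0 lm jm; have e := subnK (ltnW lm).
rewrite -e E_sum// ltn_divLR ?expn_gt0 ?r0// -expnD e jm.
by rewrite mul1n.
Qed.

(** Applied with [j] the cut index, which may lie beyond [r ^ m]; the sum is then zero. *)
Let E_sum_le r m l j : (0 < r)%N -> (l < m)%N ->
  \sum_(i < r ^ m) E r l i j <= (r ^ l)%:R.
Proof.
move=> r0 lm; have e := subnK (ltnW lm).
by rewrite -e E_sum// ler_nat; case: (_ < _)%N; rewrite ?mul1n.
Qed.

(** Blocks are intervals: one containing [i] and [j] also contains [m]. So at each level the cut
    part is dominated by a rank one matrix. *)
Let E_between r l i m j : ((i <= m <= j) || (j <= m <= i))%N ->
  E r l i j <= E r l i m * E r l j m.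
Proof.
move=> imj; rewrite /E; case: eqP => // ij; last by rewrite mulr_ge0.
have im : (i %/ r ^ l = m %/ r ^ l)%N.
  apply/eqP; rewrite eqn_leq; case/orP: imj => /andP[h1 h2].
    by rewrite leq_div2r//= ij leq_div2r.
  by apply/andP; split; [rewrite ij|]; exact: leq_div2r.
by rewrite -ij im eqxx mulr1.
Qed.

Let between (i m j : nat) := ((i <= m <= j) || (j <= m <= i))%N.

(* The witness is a small multiple of the sum of the averaging operators over
   the blocks of length [r ^ l], [l < k].  A cut at [m] separates an entry only
   if both its indices lie in the block around [m], and for a lacunary [r] the
   contributions of the levels to the cut part are almost disjoint, so that
   they add up in the l_p sense, whereas the row sums add up linearly. *)
Lemma exists_block_matrix (M : R) :
  exists (n : nat) (A : nat -> nat -> R) (L : R),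
  [/\ (0 < n)%N, M <= L /\ 0 < L, (forall i j, 0 <= A i j),
   (forall i, (i < n)%N -> \sum_(j < n) A i j = L) /\
   (forall j, (j < n)%N -> \sum_(i < n) A i j = L)
  & forall (m : nat) (a : nat -> R),
    \sum_(i < n) (\sum_(j < n)
      (((i <= m <= j) || (j <= m <= i))%N)%:R * (A i j * `|a j|)) `^ p <=
    2 `^ p * \sum_(j < n) `|a j| `^ p].
Proof.
have p10 : 0 < p - 1 by rewrite subr_gt0.
(* This makes the ratio [q = r^(-1/p)] at most one half, as [geometric_powR_le] requires. *)
have [r [r0 r2]] : exists r : nat, (0 < r)%N /\ 2 `^ p <= r%:R :> R.
  by exists (Num.truncn ((2 : R) `^ p)).+1; split=> //; rewrite ltW// truncnS_gt.
have rR0 : 0 < r%:R :> R by rewrite ltr0n.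
pose q : R := r%:R^-1 `^ p^-1.
have q0 : 0 <= q by exact: powR_ge0.
have qp : q `^ p = r%:R^-1.
  by rewrite /q -powRrM mulVf ?gt_eqF// powRr1// invr_ge0 ltW.
have q2 : q <= 2^-1.
  apply: (powR_le_inv p0) => //.
  rewrite qp -[X in _ <= X `^ _]powR_inv1// -powRrM mulN1r powRN lef_pV2// ?posrE// powR_gt0//.
(* With [k] levels and the factor [c = k^(-1/p)] the row sums are [k^((p-1)/p)], which must reach
   [|M|]. *)
have [k [k0 kM]] : exists k : nat, (0 < k)%N /\ `|M| `^ (p / (p - 1)) <= k%:R.
  exists (Num.truncn (`|M| `^ (p / (p - 1)))).+1; split=> //.
  by rewrite ltW// truncnS_gt.
have kR0 : 0 < k%:R :> R by rewrite ltr0n.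
pose c : R := k%:R^-1 `^ p^-1.
have c0 : 0 < c by rewrite powR_gt0// invr_gt0.
have cp : c `^ p = k%:R^-1.
  by rewrite /c -powRrM mulVf ?gt_eqF// powRr1// invr_ge0 ltW.
pose w l : R := (r ^ l)%:R^-1.
have w0 l : 0 < w l by rewrite invr_gt0 ltr0n expn_gt0 r0.
have wE l : w l = (q `^ p) ^+ l by rewrite qp /w natrX exprVn.
pose A i j := c * \sum_(l < k) E r l i j * w l.
have Asym i j : A i j = A j i.
  by congr (_ * _); apply: eq_bigr => l _; rewrite /E eq_sym.
have Acol j : (j < r ^ k)%N -> \sum_(i < r ^ k) A i j = c * k%:R.
  move=> jk; rewrite -mulr_sumr exchange_big/=; congr (_ * _).
  rewrite (eq_bigr (fun=> 1)) ?sumr_const ?card_ord//.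
  by move=> l _; rewrite -mulr_suml E_sum_lt// mulfV// pnatr_eq0 -lt0n expn_gt0 r0.
exists (r ^ k)%N, A, (c * k%:R); split.
- by rewrite expn_gt0 r0.
- split; last by rewrite mulr_gt0.
  apply: le_trans (ler_norm M) _.
  have pp0 : 0 < p / (p - 1) by rewrite divr_gt0.
  have ck0 : 0 <= c * k%:R by rewrite ltW// mulr_gt0.
  apply: (powR_le_inv pp0 (normr_ge0 _) ck0).
  apply: le_trans kM _.
  apply: eqP_le.
  have -> : c * k%:R = k%:R `^ ((p - 1) / p).
    rewrite /c -[X in _ * X]powRr1// -powR_inv1// -powRrM -powRD; last first.
      by rewrite (gt_eqF kR0) implybT.
    by congr (_ `^ _); field; rewrite gt_eqF.
  rewrite -powRrM (_ : _ / _ * _ = 1) ?powRr1//.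
  by field; rewrite !gt_eqF.
- move=> i j; rewrite mulr_ge0 ?(ltW c0)// sumr_ge0// => l _.
  by rewrite mulr_ge0 ?E_ge0// ltW.
- by split=> // i ik; under eq_bigr do rewrite Asym; exact: Acol.
move=> m a; set n := (r ^ k)%N.
pose S := \sum_(j < n) `|a j| `^ p.
have S0 : 0 <= S by apply: sumr_ge0 => j _; exact: powR_ge0.
(* The average of [|a|] over the level [l] block around the cut; by Jensen it is at most [q^l] times
   the l_p norm of [a]. *)
pose g l := \sum_(j < n) (w l * E r l j m) * `|a j|.
have g0 l : 0 <= g l.
  by apply: sumr_ge0 => j _; rewrite !mulr_ge0 ?E_ge0// ltW.
have gp l : (l < k)%N -> g l <= q ^+ l * S `^ p^-1.
  move=> lk; apply: (powR_le_inv p0) => //.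
    by rewrite mulr_ge0 ?exprn_ge0 ?powR_ge0.
  have -> : (q ^+ l * S `^ p^-1) `^ p = w l * S.
    rewrite powRM ?exprn_ge0 ?powR_ge0//; congr (_ * _); last first.
      by rewrite -powRrM mulVf ?gt_eqF// powRr1.
    by rewrite wE -(powR_mulrn l q0) -(powR_mulrn l (powR_ge0 q p)) -!powRrM [_ * p]mulrC.
  apply: le_trans (@powR_sum_le R p p1 n (fun j => w l * E r l j m) a _ _) _.
  - by move=> j; rewrite mulr_ge0 ?E_ge0// ltW.
  - rewrite -mulr_sumr -ler_pdivlMl// invrK mulr1; exact: E_sum_le.
  - rewrite mulr_sumr; apply: ler_sum => j _; rewrite ler_wpM2r ?powR_ge0//.
    rewrite ler_piMr ?(ltW (w0 l))// /E; by case: (_ == _)%N; rewrite ?lexx ?ler01.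
pose P i l := (i %/ r ^ l == m %/ r ^ l)%N.
(* Only the levels at which [i] lies in the block of [m] contribute to row [i]. *)
have inner (i : 'I_n) : \sum_(j < n) (between i m j)%:R * (A i j * `|a j|) <=
    c * S `^ p^-1 * \sum_(l < k) (P i l)%:R * q ^+ l.
  apply: (@le_trans _ _ (c * \sum_(l < k) E r l i m * g l)); last first.
    rewrite -mulrA ler_wpM2l ?(ltW c0)// mulr_sumr; apply: ler_sum => l _.
    by rewrite mulrCA ler_wpM2l ?E_ge0// mulrC gp.
  rewrite [leRHS](_ : _ = \sum_(j < n) \sum_(l < k)
      c * (E r l i m * (w l * E r l j m * `|a j|))); last first.
    rewrite exchange_big mulr_sumr; apply: eq_bigr => l _.
    by rewrite /g !mulr_sumr.
  apply: ler_sum => j _; case: (boolP (between i m j)) => imj; last first.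
    rewrite mul0r sumr_ge0// => l _.
    by rewrite !mulr_ge0 ?E_ge0// ltW.
  rewrite mul1r /A -mulrA mulr_suml mulr_sumr; apply: ler_sum => l _.
  rewrite ler_wpM2l ?(ltW c0)// [leRHS](_ : _ = (E r l i m * E r l j m) * w l * `|a j|).
    by rewrite !ler_wpM2r ?(ltW (w0 l))// E_between.
  by ring.
apply: (@le_trans _ _ (\sum_(i < n)
    (c `^ p * S) * (2 `^ p * \sum_(l < k) (P i l)%:R * w l))).
  apply: ler_sum => i _.
  apply: (@le_trans _ _ ((c * S `^ p^-1 * \sum_(l < k) (P i l)%:R * q ^+ l) `^ p)).
    rewrite ge0_ler_powR ?nnegrE ?(ltW p0)//.
    - apply: sumr_ge0 => j _; rewrite !mulr_ge0// ?(ltW c0)//.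
      by rewrite sumr_ge0// => l _; rewrite mulr_ge0 ?E_ge0// ltW.
    - rewrite !mulr_ge0 ?powR_ge0 ?(ltW c0)// sumr_ge0// => l _.
      by rewrite mulr_ge0 ?exprn_ge0.
    - exact: inner.
  rewrite powRM ?mulr_ge0 ?powR_ge0 ?(ltW c0)//; last first.
    by rewrite sumr_ge0// => l _; rewrite mulr_ge0 ?exprn_ge0.
  rewrite powRM ?powR_ge0 ?(ltW c0)// -[X in _ * X * _ <= _]powRrM mulVf ?gt_eqF// powRr1//.
  rewrite ler_wpM2l ?mulr_ge0 ?powR_ge0//.
  under [X in _ <= _ * X]eq_bigr do rewrite wE.
  exact: geometric_powR_le.
(* At each level at most [r ^ l] rows lie in the block of [m], each with weight [w l]. So a level
   contributes at most 1, and [c^p = 1/k] absorbs the number [k] of levels. *)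
rewrite -mulr_sumr -mulr_sumr exchange_big/= cp.
rewrite mulrACA [_ * 2 `^ p]mulrC -!mulrA ler_wpM2l ?powR_ge0//.
rewrite mulrCA ler_piMr// ler_pdivrMl// mulr1.
rewrite -[X in _ <= X%:R](card_ord k) -sumr_const ler_sum// => l _.
rewrite -mulr_suml -ler_pdivlMr// div1r invrK.
exact: E_sum_le.
Qed.

End BlockMatrix.

(** * Concatenating finite blocks of vectors into one sequence *)

Section Concatenation.
Variable sz : nat -> nat.
Hypothesis sz_gt0 : forall j, (0 < sz j)%N.

Definition offset j := (\sum_(i < j) sz i)%N.

Lemma offsetS j : offset j.+1 = (offset j + sz j)%N.
Proof. by rewrite /offset big_ord_recr. Qed.

Lemma leq_offset j : (j <= offset j)%N.
Proof.
elim: j => // j ih; rewrite offsetS -addn1; exact: leq_add.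
Qed.

Lemma offset_mono j k : (j <= k)%N -> (offset j <= offset k)%N.
Proof.
move=> /subnK <-; elim: (k - j)%N => // n ih.
by rewrite addSn offsetS (leq_trans ih)// leq_addr.
Qed.

Lemma block_index_exists k : exists j, (k < offset j.+1)%N.
Proof. by exists k; exact: leq_offset. Qed.

Definition block_index k := ex_minn (block_index_exists k).

Lemma block_indexP k :
  (offset (block_index k) <= k < offset (block_index k).+1)%N.
Proof.
rewrite /block_index; case: ex_minnP => -[|j] -> jmin; rewrite andbT.
  by rewrite /offset big_ord0.
by rewrite leqNgt; apply/negP => /jmin; rewrite ltnn.
Qed.

Lemma block_index_offset j i : (i < sz j)%N -> block_index (offset j + i) = j.
Proof.
move=> ij; have /andP[h1 h2] := block_indexP (offset j + i).
apply/eqP; rewrite eqn_leq; apply/andP; split; rewrite leqNgt; apply/negP => h.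
  have := leq_trans (offset_mono h) h1; rewrite offsetS; lia.
have := leq_trans h2 (offset_mono h); lia.
Qed.

Variables (R : realType) (zb : nat -> nat -> R -> R).

Definition concat_blocks k := zb (block_index k) (k - offset (block_index k)).

Lemma concat_blocksE j i : (i < sz j)%N -> concat_blocks (offset j + i) = zb j i.
Proof. by move=> ij; rewrite /concat_blocks block_index_offset// addKn. Qed.

Lemma lincomb_offset a J x : lincomb concat_blocks a (offset J) x =
  \sum_(j < J) \sum_(i < sz j) a (offset j + i)%N * zb j i x.
Proof.
elim: J => [|J ih]; first by rewrite /lincomb /offset !big_ord0.
rewrite big_ord_recr/= -ih /lincomb offsetS big_split_ord/=; congr (_ + _).
by apply: eq_bigr => i _; rewrite concat_blocksE.
Qed.

End Concatenation.

(** * The non-negative blocks and the bound on their partial sums *)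

Section Blocks.
Variables (R : realType) (p : R).
Hypothesis p1 : 1 < p.
Local Notation N := (Lpnorm p).
Let p0 : 0 < p. Proof. exact: lt_trans p1. Qed.

Variables (H hp hm : nat -> R -> R) (E : bool -> nat -> nat -> R -> R).
Hypothesis H_Lp : forall j, Lp p (H j).
Hypothesis hp_Lp : forall j, Lp p (hp j).
Hypothesis hm_Lp : forall j, Lp p (hm j).
Hypothesis HE : forall j x, H j x = hp j x - hm j x.
Hypothesis H_norm : forall j, N (H j) = 1.
Hypothesis hm_norm : forall j, N (hm j) <= 1.
Hypothesis H_mono : forall a m n, (m <= n)%N ->
  N (lincomb H a m) <= N (lincomb H a n).
Hypothesis E_Lp : forall b j i, Lp p (E b j i).
Hypothesis E_norm : forall b j i, N (E b j i) = 1.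
Hypothesis E_disj : forall (b : bool) (j i : nat) (b' : bool) (j' i' : nat) x, E b j i x != 0 ->
  [|| b' != b, j' != j | i' != i] -> E b' j' i' x = 0.
Hypothesis hp_off : forall b j i l x, E b j i x != 0 -> hp l x = 0.
Hypothesis hm_off : forall b j i l x, E b j i x != 0 -> hm l x = 0.

Variables (nn : nat -> nat) (A : nat -> nat -> nat -> R) (L : nat -> R).
Hypothesis nn_gt0 : forall j, (0 < nn j)%N.
Hypothesis L_ge1 : forall j, 1 <= L j.
Hypothesis L_sum : forall J, \sum_(j < J) (L j)^-1 <= 1.
Hypothesis A_row : forall j i, (i < nn j)%N -> \sum_(n < nn j) A j i n = L j.
Hypothesis A_col : forall j n, (n < nn j)%N -> \sum_(i < nn j) A j i n = L j.
Hypothesis A_ge0 : forall j i n, 0 <= A j i n.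
Hypothesis A_cut : forall j (m : nat) (a : nat -> R),
  \sum_(i < nn j) (\sum_(n < nn j)
    (((i <= m <= n) || (n <= m <= i))%N)%:R * (A j i n * `|a n|)) `^ p <=
  2 `^ p * \sum_(n < nn j) `|a n| `^ p.

Let nR_gt0 j : 0 < (nn j)%:R :> R. Proof. by rewrite ltr0n. Qed.
Let L_gt0 j : 0 < L j. Proof. exact: lt_le_trans (L_ge1 j). Qed.

(** The normalization for which the constant coefficient sequence [s] is spread to a vector of norm
    [|s|]. *)
Definition kappa j : R := (nn j)%:R^-1 `^ p^-1.

Let kappa_ge0 j : 0 <= kappa j. Proof. exact: powR_ge0. Qed.

Let kappaX j : kappa j `^ p = (nn j)%:R^-1.
Proof.
by rewrite /kappa -powRrM mulVf ?gt_eqF// powRr1// invr_ge0 ltW.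
Qed.

Definition spread (b : bool) (j : nat) (v : nat -> R) : R -> R :=
  fun x => kappa j * \sum_(i < nn j) v i * E b j i x.

Lemma Lp_spread b j v : Lp p (spread b j v).
Proof. by apply: LpZ => //; apply: Lp_sum => // i _; exact: LpZ. Qed.

Let E_mul0 b j i i' x : i != i' -> E b j i x * E b j i' x = 0.
Proof.
move=> ii'; have [->|h] := eqVneq (E b j i x) 0; first by rewrite mul0r.
by rewrite (@E_disj b j i b j i' x h) ?mulr0// (eq_sym i') ii' !orbT.
Qed.

Lemma spread_normX b j v :
  N (spread b j v) `^ p = (\sum_(i < nn j) `|v i| `^ p) / (nn j)%:R.
Proof.
have main n : N (fun x => \sum_(i < n) v i * E b j i x) `^ p = \sum_(i < n) `|v i| `^ p.
  elim: n => [|n ih].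
    rewrite big_ord0 (_ : (fun x => _) = fun=> 0) ?Lpnorm0 ?powR0 ?gt_eqF//.
    by apply/funext => x; rewrite big_ord0.
  rewrite (_ : (fun x => _) = fun x => \sum_(i < n) v i * E b j i x + v n * E b j n x).
    rewrite LpnormX_disjoint//.
    - by rewrite ih big_ord_recr/= LpnormZ// E_norm mulr1.
    - by apply: Lp_sum => // i _; exact: LpZ.
    - exact: LpZ.
    - move=> x; rewrite mulr_suml big1// => i _.
      by rewrite mulrACA E_mul0 ?mulr0// neq_ltn ltn_ord.
  by apply/funext => x; rewrite big_ord_recr.
rewrite LpnormZ//; last by apply: Lp_sum => // i _; exact: LpZ.
by rewrite powRM ?Lpnorm_ge0// ger0_norm// kappaX main mulrC.
Qed.

Lemma spread_norm_le b b' j v w :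
  (forall i, (i < nn j)%N -> `|v i| <= `|w i|) ->
  N (spread b j v) <= N (spread b' j w).
Proof.
move=> vw; apply: (powR_le_inv p0); rewrite ?Lpnorm_ge0// !spread_normX.
rewrite ler_wpM2r ?invr_ge0 ?(ltW (nR_gt0 j))//; apply: ler_sum => i _.
by rewrite ge0_ler_powR ?nnegrE ?(ltW p0)// vw.
Qed.

Lemma spread_norm_eq b b' j v : N (spread b j v) = N (spread b' j v).
Proof. by apply/eqP; rewrite eq_le; apply/andP; split; exact: spread_norm_le. Qed.

Lemma spread_norm_cst b j s : N (spread b j (fun=> s)) = `|s|.
Proof.
have e : N (spread b j (fun=> s)) `^ p = `|s| `^ p.
  by rewrite spread_normX sumr_const card_ord -[X in X / _]mulr_natr mulfK ?gt_eqF.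
by apply/eqP; rewrite eq_le; apply/andP; split; apply: (powR_le_inv p0);
  rewrite ?Lpnorm_ge0// e.
Qed.

Lemma spreadD b j v w x :
  spread b j (fun i => v i + w i) x = spread b j v x + spread b j w x.
Proof.
rewrite /spread -mulrDr -big_split/=; congr (_ * _).
by apply: eq_bigr => i _; rewrite mulrDl.
Qed.

Lemma spread_normD b j v w :
  N (spread b j (fun i => v i + w i)) <= N (spread b j v) + N (spread b j w).
Proof.
rewrite (_ : spread _ _ (fun i => _) = fun x => spread b j v x + spread b j w x).
  by apply: LpnormD => //; exact: Lp_spread.
by apply/funext => x; exact: spreadD.
Qed.

(** Jensen's inequality with the uniform weights, as the norm of a spread is the [p]-mean of its
    coefficients. *)
Lemma mean_le b j (v : nat -> R) : `|(\sum_(i < nn j) v i) / (nn j)%:R| <= N (spread b j v).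
Proof.
have n0 : 0 <= (nn j)%:R^-1 :> R by rewrite invr_ge0 ltW.
apply: (powR_le_inv p0); rewrite ?Lpnorm_ge0// spread_normX.
have h1 : \sum_(i < nn j) (nn j)%:R^-1 <= 1 :> R.
  by rewrite sumr_const card_ord -[leLHS]mulr_natl mulfV// gt_eqF.
have := @powR_sum_le R p p1 (nn j) (fun=> (nn j)%:R^-1) v (fun=> n0) h1.
rewrite -!mulr_sumr ![(nn j)%:R^-1 * _]mulrC => h2; apply: le_trans _ h2.
rewrite ge0_ler_powR ?nnegrE ?(ltW p0)// ?mulr_ge0 ?sumr_ge0//.
by rewrite normrM (ger0_norm n0) ler_wpM2r// ler_norm_sum.
Qed.

(* Coordinates of a vector [sum_i c_2i zodd_i + c_2i+1 zeven_i] of the [j]-th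
   block in terms of [H j], [hm j], [E false j] and [E true j], see [blockE]. *)
Definition tj j (c : nat -> R) := (\sum_(i < nn j) c i.*2) / (nn j)%:R.
Definition dj j (c : nat -> R) i :=
  c i.*2.+1 + \sum_(n < nn j) A j i n * c n.*2.
Definition tauj j (c : nat -> R) :=
  (\sum_(i < nn j) dj j c i) / (nn j)%:R / L j.
Definition vj j c i := c i.*2 - tj j c + tauj j c.

(* Adding up the odd vectors and subtracting [L j] times the even ones leaves
   [hp j - hm j = H j]: both kinds of atoms cancel, see [block_basis_vector]. *)
Definition zodd j n : R -> R := fun x => hp j x / (nn j)%:R
  + kappa j * E false j n x + kappa j * \sum_(i < nn j) A j i n * E true j i x.
Definition zeven j i : R -> R := fun x =>
  (hm j x + kappa j * \sum_(n < nn j) E false j n x) / ((nn j)%:R * L j)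
  + kappa j * E true j i x.
(** Positions are counted from 0, so the [zodd] vectors stand at even [k] and the [zeven] vectors at
    odd [k]. *)
Definition zb j k := if odd k then zeven j k./2 else zodd j k./2.

Definition block j (c : nat -> R) : R -> R :=
  fun x => \sum_(k < (nn j).*2) c k * zb j k x.

Lemma Lp_zb j k : Lp p (zb j k).
Proof.
have lH a (f : R -> R) : Lp p f -> Lp p (fun x => f x / a).
  by move=> lf; rewrite (_ : (fun x => _) = fun x => a^-1 * f x);
    [exact: LpZ|apply/funext => x; rewrite mulrC].
rewrite /zb; case: (odd k); rewrite /zeven /zodd.
- apply: (LpD p1); last exact: LpZ.
  apply: lH; apply: (LpD p1) => //; apply: LpZ => //; exact: Lp_sum.
- apply: (LpD p1); last by apply: LpZ => //; apply: Lp_sum => // i _; exact: LpZ.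
  by apply: (LpD p1); [exact: lH|exact: LpZ].
Qed.

Lemma block_split j c x : block j c x =
  \sum_(n < nn j) (c n.*2 * zodd j n x + c n.*2.+1 * zeven j n x).
Proof.
rewrite /block; elim: (nn j) => [|n ih]; first by rewrite !big_ord0.
rewrite doubleS !big_ord_recr/= ih -addrA; congr (_ + (_ * _ + _ * _)).
  by rewrite /zb odd_double doubleK.
by rewrite /zb /= odd_double/= uphalf_double.
Qed.

(** The coefficient of [hp j] is [tj]. The column sums of [A] give [tauj - tj] as the coefficient of
    [hm j] and as the correction common to all first atoms. Writing [hp = H + hm] leaves only the
    small multiple [tauj] of [hm j]. *)
Lemma blockE j c x : block j c x = tj j c * H j x + tauj j c * hm j x
  + spread false j (vj j c) x + spread true j (dj j c) x.
Proof.
have n0 : (nn j)%:R != 0 :> R by rewrite gt_eqF.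
have l0 : L j != 0 by rewrite gt_eqF.
set sa := \sum_(i < nn j) c i.*2; set sb := \sum_(i < nn j) c i.*2.+1.
pose eF := \sum_(n < nn j) E false j n x.
have Sd : \sum_(i < nn j) dj j c i = sb + L j * sa.
  rewrite /dj big_split/=; congr (_ + _); rewrite exchange_big/= mulr_sumr.
  by apply: eq_bigr => n _; rewrite -mulr_suml A_col.
have tau : tauj j c = sb / ((nn j)%:R * L j) + tj j c.
  rewrite /tauj Sd /tj -/sa; field; rewrite n0 l0//.
have h1 : \sum_(n < nn j) c n.*2 * zodd j n x = tj j c * hp j x
    + kappa j * \sum_(n < nn j) c n.*2 * E false j n x
    + kappa j * \sum_(i < nn j) (\sum_(n < nn j) A j i n * c n.*2) * E true j i x.
  have -> : tj j c * hp j x = \sum_(n < nn j) c n.*2 * (hp j x / (nn j)%:R).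
    by rewrite -mulr_suml /tj; ring.
  have -> : \sum_(i < nn j) (\sum_(n < nn j) A j i n * c n.*2) * E true j i x =
      \sum_(n < nn j) c n.*2 * (\sum_(i < nn j) A j i n * E true j i x).
    under eq_bigr do rewrite mulr_suml.
    rewrite exchange_big; apply: eq_bigr => n _; rewrite mulr_sumr.
    by apply: eq_bigr => i _; ring.
  rewrite !mulr_sumr -!big_split/=; apply: eq_bigr => n _.
  by rewrite /zodd; ring.
have h2 : \sum_(n < nn j) c n.*2.+1 * zeven j n x =
    sb / ((nn j)%:R * L j) * (hm j x + kappa j * eF)
    + kappa j * \sum_(i < nn j) c i.*2.+1 * E true j i x.
  have -> : sb / ((nn j)%:R * L j) * (hm j x + kappa j * eF) =
      \sum_(n < nn j) c n.*2.+1 * ((hm j x + kappa j * eF) / ((nn j)%:R * L j)).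
    by rewrite -mulr_suml -/sb mulrA mulrAC.
  rewrite [X in _ + X]mulr_sumr -big_split/=.
  by apply: eq_bigr => n _; rewrite /zeven -/eF; ring.
have h3 : spread false j (vj j c) x = kappa j * \sum_(n < nn j) c n.*2 * E false j n x
    + (tauj j c - tj j c) * (kappa j * eF).
  rewrite /spread mulrCA -mulrDr; congr (_ * _).
  rewrite /eF mulr_sumr -big_split/=; apply: eq_bigr => n _.
  by rewrite /vj; ring.
have h4 : spread true j (dj j c) x = kappa j * \sum_(i < nn j) c i.*2.+1 * E true j i x
    + kappa j * \sum_(i < nn j) (\sum_(n < nn j) A j i n * c n.*2) * E true j i x.
  rewrite /spread -mulrDr -big_split/=; congr (_ * _).
  by apply: eq_bigr => n _; rewrite /dj mulrDl.
rewrite block_split big_split/= h1 h2 h3 h4 HE tau.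
by ring.
Qed.


Definition blocks (C : nat -> nat -> R) J : R -> R :=
  fun x => \sum_(j < J) block j (C j) x.

Definition main_part (C : nat -> nat -> R) J : R -> R :=
  fun x => \sum_(j < J) (tj j (C j) * H j x + tauj j (C j) * hm j x).

Definition extra_part (C : nat -> nat -> R) J : R -> R :=
  fun x => \sum_(j < J) (spread false j (vj j (C j)) x + spread true j (dj j (C j)) x).

Definition coord (b : bool) j c := if b then dj j c else vj j c.

Lemma Lp_blocks (C : nat -> nat -> R) J : Lp p (blocks C J).
Proof.
by apply: Lp_sum => // j _; apply: Lp_sum => // k _; apply: LpZ => //; exact: Lp_zb.
Qed.

Lemma Lp_main_part (C : nat -> nat -> R) J : Lp p (main_part C J).
Proof. by apply: Lp_sum => // j _; apply: (LpD p1); exact: LpZ. Qed.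

Lemma Lp_extra_part (C : nat -> nat -> R) J : Lp p (extra_part C J).
Proof. by apply: Lp_sum => // j _; apply: (LpD p1); exact: Lp_spread. Qed.

Lemma blocks_split (C : nat -> nat -> R) J x : blocks C J x = main_part C J x + extra_part C J x.
Proof.
rewrite /blocks /main_part /extra_part -big_split/=; apply: eq_bigr => j _.
by rewrite blockE addrA.
Qed.

Lemma spread_at b j i x b' j' v : E b j i x != 0 ->
  spread b' j' v x = if (b' == b) && (j' == j) then spread b j v x else 0.
Proof.
move=> h; case: ifPn => [/andP[/eqP -> /eqP ->]//|bj].
rewrite /spread big1 ?mulr0// => i' _.
rewrite (@E_disj b j i b' j' i' x h) ?mulr0//.
by move: bj; rewrite negb_and => /orP[->//|->]; rewrite orbT.
Qed.

Lemma spread_neq0 b j v x : spread b j v x != 0 -> exists i, E b j i x != 0.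
Proof.
move=> /eqP s0; apply: contrapT => h; apply: s0; rewrite /spread big1 ?mulr0// => i _.
have [->|e] := eqVneq (E b j i x) 0; first by rewrite mulr0.
by case: h; exists i.
Qed.

Lemma main_part_at b j i x (C : nat -> nat -> R) J : E b j i x != 0 -> main_part C J x = 0.
Proof.
move=> h; rewrite /main_part big1// => l _.
by rewrite HE (hp_off l h) (hm_off l h) subr0 !mulr0 addr0.
Qed.

Lemma extra_part_at b j i x (C : nat -> nat -> R) J : E b j i x != 0 ->
  extra_part C J x = if (j < J)%N then spread b j (coord b j (C j)) x else 0.
Proof.
move=> h.
have -> : (if (j < J)%N then spread b j (coord b j (C j)) x else 0) =
    \sum_(l < J | l == j :> nat) spread b l (coord b l (C l)) x.
  by rewrite (big_ord1_eq _ (fun l => spread b l (coord b l (C l)) x)).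
rewrite [RHS]big_mkcond/=; apply: eq_bigr => l _.
rewrite (spread_at false l _ h) (spread_at true l _ h).
by case: b h => h /=; case: (eqVneq (l : nat) j) => [->|]; rewrite ?add0r ?addr0.
Qed.

Lemma extra_part_off x (C : nat -> nat -> R) J :
  (forall b j i, E b j i x = 0) -> extra_part C J x = 0.
Proof.
by move=> h; rewrite /extra_part big1// => l _; rewrite /spread !big1 ?mulr0 ?addr0// => i _;
  rewrite h mulr0.
Qed.

Lemma E_cases x : (exists b j i, E b j i x != 0) \/ (forall b j i, E b j i x = 0).
Proof.
have [h|h] := pselect (exists b j i, E b j i x != 0); [by left|right] => b j i.
by apply/eqP; apply: contra_notT h => e; exists b, j, i.
Qed.

(** The domination is pointwise: the main part vanishes where some atom is non-zero, and elsewhere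
    it is the whole sum. The next two bounds are obtained in the same way from the values on the
    atoms. *)
Lemma main_part_le (C : nat -> nat -> R) J : N (main_part C J) <= N (blocks C J).
Proof.
apply: Lpnorm_le => //; [by case: (Lp_main_part C J)|exact: Lp_blocks|].
move=> x; rewrite blocks_split; have [[b [j [i h]]]|h] := E_cases x.
  by rewrite (main_part_at C J h) normr0.
by rewrite extra_part_off// addr0.
Qed.

Lemma extra_part_le (C : nat -> nat -> R) m J : (m <= J)%N -> N (extra_part C m) <= N (blocks C J).
Proof.
move=> mJ; apply: Lpnorm_le => //; [by case: (Lp_extra_part C m)|exact: Lp_blocks|].
move=> x; rewrite blocks_split; have [[b [j [i h]]]|h] := E_cases x; last first.
  by rewrite (extra_part_off C m h) normr0.
rewrite (main_part_at C J h) add0r !(extra_part_at _ _ h).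
by case: (ltnP j m) => jm; [rewrite (leq_trans jm mJ)|rewrite normr0].
Qed.

Lemma spread_le (C : nat -> nat -> R) b j J : (j < J)%N ->
  N (spread b j (coord b j (C j))) <= N (blocks C J).
Proof.
move=> jJ; apply: Lpnorm_le => //; [by case: (Lp_spread b j (coord b j (C j)))|exact: Lp_blocks|].
move=> x; have [->|/spread_neq0[i h]] := eqVneq (spread b j (coord b j (C j)) x) 0.
  by rewrite normr0.
by rewrite blocks_split (main_part_at C J h) add0r (extra_part_at C J h) jJ.
Qed.

Lemma tauj_le_spread j c : `|tauj j c| <= N (spread true j (dj j c)) / L j.
Proof.
rewrite normrM (ger0_norm (x := (L j)^-1)) ?invr_ge0 ?(ltW (L_gt0 j))//.
by rewrite ler_wpM2r ?invr_ge0 ?(ltW (L_gt0 j))// -(spread_norm_eq false) mean_le.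
Qed.

Lemma tauj_le_spread1 j c : `|tauj j c| <= N (spread true j (dj j c)).
Proof.
apply: le_trans (tauj_le_spread j c) _.
by rewrite ler_pdivrMr// ler_peMr// Lpnorm_ge0.
Qed.

(** This is where large [L j] matter: each [tauj] is bounded by the norm of the sum divided by
    [L j], and the inverses sum to at most 1. *)
Lemma sum_tauj_le (C : nat -> nat -> R) m J : (m <= J)%N ->
  \sum_(j < m) `|tauj j (C j)| <= N (blocks C J).
Proof.
move=> mJ; apply: (@le_trans _ _ (N (blocks C J) * \sum_(j < m) (L j)^-1)).
  rewrite mulr_sumr; apply: ler_sum => j _.
  apply: le_trans (tauj_le_spread j (C j)) _.
  rewrite ler_wpM2r ?invr_ge0 ?(ltW (L_gt0 j))//.
  by apply: (@spread_le C true); exact: leq_trans mJ.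
by rewrite ler_piMr ?Lpnorm_ge0.
Qed.

Lemma Lpnorm_tau_part (C : nat -> nat -> R) m J : (m <= J)%N ->
  N (fun x => \sum_(j < m) tauj j (C j) * hm j x) <= N (blocks C J).
Proof.
move=> mJ; apply: le_trans (sum_tauj_le C mJ).
have lh (j : 'I_m) : true -> Lp p (fun x => tauj j (C j) * hm j x).
  by move=> _; exact: LpZ.
apply: le_trans (Lpnorm_sum p1 (index_enum _) lh) _.
apply: ler_sum => j _; rewrite LpnormZ// ler_piMr//.
Qed.

Lemma Lp_tau_part (C : nat -> nat -> R) m : Lp p (fun x => \sum_(j < m) tauj j (C j) * hm j x).
Proof. by apply: Lp_sum => // j _; exact: LpZ. Qed.

Let lc (C : nat -> nat -> R) := lincomb H (fun j => tj j (C j)).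

Lemma main_partE (C : nat -> nat -> R) m x :
  main_part C m x = lc C m x + \sum_(j < m) tauj j (C j) * hm j x.
Proof. by rewrite /main_part big_split. Qed.

(** Monotonicity of the system [H] reduces to [m = J], where the combination is the main part minus
    the [tauj] error; each costs one norm. *)
Lemma lincomb_tj_le (C : nat -> nat -> R) m J : (m <= J)%N -> N (lc C m) <= 2 * N (blocks C J).
Proof.
move=> mJ; apply: le_trans (H_mono _ mJ) _.
rewrite (_ : lincomb _ _ _ = fun x => main_part C J x -
    \sum_(j < J) tauj j (C j) * hm j x); last first.
  by apply/funext => x; rewrite main_partE addrK.
apply: le_trans (LpnormB p1 (Lp_main_part _ _) (Lp_tau_part _ _)) _.
by rewrite mulrDl mul1r lerD ?main_part_le// Lpnorm_tau_part.
Qed.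

Lemma blocks_partial_le (C : nat -> nat -> R) m J : (m <= J)%N ->
  N (blocks C m) <= 4 * N (blocks C J).
Proof.
move=> mJ.
have lL : Lp p (lc C m) by exact: Lp_lincomb.
rewrite (_ : blocks C m = fun x => (lc C m x + \sum_(j < m) tauj j (C j) * hm j x)
   + extra_part C m x); last first.
  by apply/funext => x; rewrite blocks_split main_partE.
apply: le_trans (LpnormD p1 (LpD p1 lL (Lp_tau_part _ _)) (Lp_extra_part _ _)) _.
(* The three terms are the combination of the [H j], the [tauj] error and the atoms. *)
apply: (@le_trans _ _ (2 * N (blocks C J) + N (blocks C J) + N (blocks C J))).
  rewrite lerD ?extra_part_le//.
  apply: le_trans (LpnormD p1 lL (Lp_tau_part _ _)) _.
  by rewrite lerD ?lincomb_tj_le// Lpnorm_tau_part.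
by apply: eqP_le; ring.
Qed.

Lemma tj_le (C : nat -> nat -> R) j J : (j < J)%N -> `|tj j (C j)| <= 4 * N (blocks C J).
Proof.
move=> jJ; rewrite -[leLHS]mulr1 -[X in _ * X <= _](H_norm j) -LpnormZ//.
rewrite (_ : (fun x => _) = fun x => lc C j.+1 x - lc C j x); last first.
  by apply/funext => x; rewrite /lc lincombS addrC addKr.
apply: le_trans (LpnormB p1 (Lp_lincomb p1 H_Lp _ _) (Lp_lincomb p1 H_Lp _ _)) _.
apply: le_trans (lerD (lincomb_tj_le C jJ) (lincomb_tj_le C (ltnW jJ))) _.
by apply: eqP_le; ring.
Qed.

(** Undoing the shift in [vj] costs [1 + 4 + 1], for [vj], [tj] and [tauj]. *)
Lemma spread_coef_le (C : nat -> nat -> R) j J : (j < J)%N ->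
  N (spread false j (fun i => C j i.*2)) <= 6 * N (blocks C J).
Proof.
move=> jJ.
rewrite (_ : spread _ _ _ =
    spread false j (fun i => vj j (C j) i + (tj j (C j) - tauj j (C j)))); last first.
  by congr (spread _ _ _); apply/funext => i; rewrite /vj; ring.
apply: le_trans (spread_normD _ _ _ _) _; rewrite spread_norm_cst.
have h1 := @spread_le C false j J jJ.
have h2 := tj_le C jJ.
have h3 := le_trans (tauj_le_spread1 j (C j)) (@spread_le C true j J jJ).
have h4 := ler_normB (tj j (C j)) (tauj j (C j)).
move: h1 h2 h3 h4; rewrite /coord; set X := N (blocks C J).
by lra.
Qed.

Definition cut (m : nat) (c : nat -> R) k := if (k < m)%N then c k else 0.

(** If position [2i+1] survives the cut, the lost entries of row [i] have [2n >= m], hence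
    [i <= m./2 <= n]. If it does not, the only remaining entries have [2n < m], hence
    [n <= m./2 <= i]. Thanks to the alternating order the error is a cut part of [A] either way. *)
Lemma dj_cut_le j m c i : `|dj j (cut m c) i| <= `|dj j c i| +
  \sum_(n < nn j) (((i <= m./2 <= n) || (n <= m./2 <= i))%N)%:R * (A j i n * `|c n.*2|).
Proof.
pose B n := A j i n * c n.*2.
pose btw n := ((i <= m./2 <= n) || (n <= m./2 <= i))%N.
have nB n : `|B n| = A j i n * `|c n.*2| by rewrite normrM ger0_norm.
have half k : (k.*2 < m)%N -> (k <= m./2)%N by move=> h; lia.
have [im|mi] := ltnP i.*2.+1 m.
  have -> : dj j (cut m c) i = dj j c i - \sum_(n < nn j) (if (n.*2 < m)%N then 0 else B n).
    rewrite /dj /cut im -addrA; congr (_ + _); rewrite -sumrB; apply: eq_bigr => n _.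
    by rewrite /B; case: ifP => _; rewrite ?subr0// mulr0 subrr.
  apply: le_trans (ler_normB _ _) _; rewrite lerD2l.
  apply: le_trans (ler_norm_sum _ _ _) _; apply: ler_sum => n _.
  rewrite -nB; case: ifPn => nm; first by rewrite normr0 mulr_ge0.
  by rewrite (_ : _ || _ = true) ?mul1r//; lia.
have -> : dj j (cut m c) i = \sum_(n < nn j) (if (n.*2 < m)%N then B n else 0).
  rewrite /dj /cut ltnNge mi add0r; apply: eq_bigr => n _.
  by rewrite /B; case: ifP => _; rewrite ?mulr0.
apply: le_trans (ler_norm_sum _ _ _) _; apply: ler_wpDl => //; apply: ler_sum => n _.
rewrite -nB; case: ifPn => nm; last by rewrite normr0 mulr_ge0.
by rewrite (_ : _ || _ = true) ?mul1r//; lia.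
Qed.

Lemma spread_dj_cut_le j m c : N (spread true j (dj j (cut m c))) <=
  N (spread true j (dj j c)) + 2 * N (spread false j (fun i => c i.*2)).
Proof.
pose err i := \sum_(n < nn j)
  (((i <= m./2 <= n) || (n <= m./2 <= i))%N)%:R * (A j i n * `|c n.*2|).
have err0 i : 0 <= err i by apply: sumr_ge0 => n _; rewrite !mulr_ge0.
apply: (@le_trans _ _ (N (spread true j (fun i => `|dj j c i| + err i)))).
  by apply: spread_norm_le => i _; rewrite [leRHS]ger0_norm ?addr_ge0// dj_cut_le.
apply: le_trans (spread_normD _ _ _ _) _; apply: lerD.
  by apply: spread_norm_le => i _; rewrite normr_id.
apply: (powR_le_inv p0); rewrite ?mulr_ge0 ?Lpnorm_ge0//.
rewrite powRM ?Lpnorm_ge0// !spread_normX mulrA.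
rewrite ler_wpM2r ?invr_ge0 ?(ltW (nR_gt0 j))//.
(* The constant [2^p] of the cut bound becomes the factor 2 after the [p]-th root. *)
apply: le_trans (A_cut j m./2 (fun n => c n.*2)).
by apply: eqP_le; apply: eq_bigr => i _; rewrite ger0_norm.
Qed.

(** Bounds for the four coordinates of the cut block, in units of [X]: 6 for [tj], [13 = 1 + 2 * 6]
    for [dj] and hence for [tauj], and [25 = 6 + 13 + 6] for [vj]. By [blockE] the total is
    [6 + 13 + 25 + 13 = 57]. *)
Lemma block_cut_le (C : nat -> nat -> R) j J m : (j < J)%N ->
  N (block j (cut m (C j))) <= 57 * N (blocks C J).
Proof.
move=> jJ; set c := cut m (C j); set X := N (blocks C J).
have ha : N (spread false j (fun i => c i.*2)) <= 6 * X.
  apply: le_trans (spread_coef_le C jJ); apply: spread_norm_le => i _.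
  by rewrite /c /cut; case: ifP => // _; rewrite normr0.
have ht : `|tj j c| <= 6 * X by apply: le_trans (mean_le _ _ _) ha.
have hd : N (spread true j (dj j c)) <= 13 * X.
  apply: le_trans (spread_dj_cut_le _ _ _) _.
  have := @spread_le C true j J jJ; have := spread_coef_le C jJ.
  by rewrite /coord -/X; set u := N _; set v := N _; lra.
have htau := le_trans (tauj_le_spread1 j c) hd.
have hv : N (spread false j (vj j c)) <= 25 * X.
  rewrite (_ : spread _ _ _ = spread false j (fun i => c i.*2 + (tauj j c - tj j c))).
    apply: le_trans (spread_normD _ _ _ _) _; rewrite spread_norm_cst.
    have := ler_normB (tauj j c) (tj j c); lra.
  by congr (spread _ _ _); apply/funext => i; rewrite /vj; ring.
rewrite (_ : block j c = fun x => (tj j c * H j x + tauj j c * hm j x)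
  + spread false j (vj j c) x + spread true j (dj j c) x); last first.
  by apply/funext => x; rewrite blockE.
have l1 : Lp p (fun x => tj j c * H j x) by exact: LpZ.
have l2 : Lp p (fun x => tauj j c * hm j x) by exact: LpZ.
have l3 := Lp_spread false j (vj j c); have l4 := Lp_spread true j (dj j c).
have l12 := LpD p1 l1 l2; have l123 := LpD p1 l12 l3.
apply: le_trans (LpnormD p1 l123 l4) _.
have h12 := LpnormD p1 l1 l2; have h123 := LpnormD p1 l12 l3.
rewrite (LpnormZ p1 _ (H_Lp j)) (LpnormZ p1 _ (hm_Lp j)) H_norm mulr1 in h12.
have h4 : `|tauj j c| * N (hm j) <= `|tauj j c| by rewrite ler_piMr.
move: h12 h123 h4 ht hd htau hv.
move: (N _) (N _) (N _) (N _) (`|tauj j c| * _) => ? ? ? ? ?; lra.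
Qed.

Hypothesis hp_ge0 : forall j x, 0 <= hp j x.
Hypothesis hm_ge0 : forall j x, 0 <= hm j x.
Hypothesis E_ge0 : forall b j i x, 0 <= E b j i x.

(** Each vector is an atom plus non-negative terms, which gives both its sign and a positive lower
    bound for its norm. *)
Lemma zb_ge_atom j k x : 0 <= kappa j * E (odd k) j k./2 x <= zb j k x.
Proof.
have n0 : 0 <= (nn j)%:R :> R by exact: ltW.
rewrite mulr_ge0//= /zb; case: (odd k); rewrite /zodd /zeven.
  by rewrite lerDr divr_ge0 ?addr_ge0 ?mulr_ge0 ?sumr_ge0// ltW.
rewrite addrAC lerDr addr_ge0 ?divr_ge0// mulr_ge0// sumr_ge0// => i _.
by rewrite mulr_ge0.
Qed.

Lemma zb_ge0 j k x : 0 <= zb j k x.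
Proof. by have /andP[h1 h2] := zb_ge_atom j k x; exact: le_trans h2. Qed.

Lemma zb_norm_gt0 j k : 0 < N (zb j k).
Proof.
apply: (@lt_le_trans _ _ (N (fun x => kappa j * E (odd k) j k./2 x))).
  by rewrite LpnormZ// E_norm mulr1 normr_gt0 gt_eqF// powR_gt0 ?invr_gt0.
have lE : Lp p (fun x => kappa j * E (odd k) j k./2 x) by exact: LpZ.
apply: Lpnorm_le => //; [by case: lE|exact: Lp_zb|] => x.
by have /andP[h1 h2] := zb_ge_atom j k x; rewrite !ger0_norm ?zb_ge0.
Qed.

(** For these coefficients the row sums of [A] make [dj] vanish, so [tauj] and [vj] vanish too and
    [tj] is 1. *)
Lemma block_basis_vector j x :
  block j (fun k => if odd k then - L j else 1) x = H j x.
Proof.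
rewrite blockE; set c := fun k => _.
have ca i : c i.*2 = 1 by rewrite /c odd_double.
have t1 : tj j c = 1.
  rewrite /tj (eq_bigr (fun=> 1)) => [|i _]; last by rewrite ca.
  by rewrite sumr_const card_ord mulfV// gt_eqF.
have d0 i : (i < nn j)%N -> dj j c i = 0.
  move=> ij; rewrite /dj (eq_bigr (fun n : 'I__ => A j i n)) => [|n _].
    by rewrite A_row// /c /= odd_double addNr.
  by rewrite ca mulr1.
have u0 : tauj j c = 0 by rewrite /tauj big1 ?mul0r// => i _; rewrite d0.
rewrite t1 u0 mul1r mul0r addr0 /spread !big1 ?mulr0 ?addr0// => i _.
  by rewrite d0 ?mul0r.
by rewrite /vj ca t1 u0 subrr addr0 mul0r.
Qed.

Let sz j := (nn j).*2.

Let sz_gt0 j : (0 < sz j)%N. Proof. by rewrite double_gt0. Qed.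

Let z := concat_blocks sz_gt0 zb.

(** The truncated subtraction [m - offset sz j] is 0 for blocks after [m], which are removed, and at
    least [sz j] for blocks before it, which stay whole. *)
Let z_cut a m n J : (m <= n)%N -> (n <= offset sz J)%N ->
  lincomb z a m = blocks (fun j => cut (m - offset sz j)
    (fun i => if (offset sz j + i < n)%N then a (offset sz j + i)%N else 0)) J.
Proof.
move=> mn nJ; rewrite -(lincomb_pad z a (leq_trans mn nJ)).
apply/funext => x; rewrite lincomb_offset; apply: eq_bigr => j _; apply: eq_bigr => i _.
rewrite /cut ltn_subRL; case: ifP => // im.
by rewrite (leq_trans im mn).
Qed.

Let z_full a n J : (n <= offset sz J)%N -> lincomb z a n = blocks (fun j i =>
    if (offset sz j + i < n)%N then a (offset sz j + i)%N else 0) J.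
Proof.
move=> nJ; rewrite (z_cut a (leqnn n) nJ); apply/funext => x.
apply: eq_bigr => j _; apply: eq_bigr => i _; rewrite /cut ltn_subRL.
by case: (_ < n)%N.
Qed.

(** Only the block containing position [m] is really cut: [61 = 4 + 57], for the complete blocks
    before it and for the cut one. *)
Lemma blocks_cut_le (C : nat -> nat -> R) m J :
  N (blocks (fun j => cut (m - offset sz j) (C j)) J) <= 61 * N (blocks C J).
Proof.
have /andP[h1 h2] := block_indexP sz_gt0 m; set k := block_index sz_gt0 m in h1 h2.
have full j x : (j < k)%N -> block j (cut (m - offset sz j) (C j)) x = block j (C j) x.
  move=> jk; apply: eq_bigr => i _; rewrite /cut ltn_subRL.
  rewrite ifT// (leq_trans _ h1)// (leq_trans _ (offset_mono sz jk))//.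
  by rewrite offsetS ltn_add2l.
have none j x : (k < j)%N -> block j (cut (m - offset sz j) (C j)) x = 0.
  move=> kj; rewrite /block big1// => i _; rewrite /cut ltn_subRL ifF ?mul0r//.
  apply/negbTE; rewrite -leqNgt (leq_trans (ltnW h2))//.
  by rewrite (leq_trans (offset_mono sz kj))// leq_addr.
have X0 : 0 <= N (blocks C J) by exact: Lpnorm_ge0.
have [kJ|Jk] := ltnP k J; last first.
  rewrite (_ : blocks _ _ = blocks C J); first by rewrite ler_peMl// ler1n.
  apply/funext => x; apply: eq_bigr => j _; apply: full.
  exact: leq_trans (ltn_ord j) Jk.
rewrite (_ : blocks _ _ = fun x => blocks C k x + block k (cut (m - offset sz k) (C k)) x).
  apply: le_trans (LpnormD p1 (Lp_blocks C k) _) _.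
    by apply: Lp_sum => // i _; apply: LpZ => //; exact: Lp_zb.
  have := blocks_partial_le C (ltnW kJ).
  by have := @block_cut_le C k J (m - offset sz k) kJ; lra.
apply/funext => x; rewrite /blocks.
rewrite -[LHS](big_mkord xpredT (fun j => block j (cut (m - offset sz j) (C j)) x)).
rewrite (big_cat_nat (n := k.+1))//= [X in _ + X]big_nat_cond [X in _ + X]big1 => [|j].
  rewrite addr0 big_mkord big_ord_recr/=; congr (_ + _).
  by apply: eq_bigr => j _; exact: full.
by rewrite andbT => /andP[kj _]; exact: none.
Qed.

Lemma exists_positive_basic_sequence : exists z : nat -> R -> R,
  [/\ schauder_basic p z, forall j x, 0 <= z j x &
    forall a n, exists m b, lincomb z b m = lincomb H a n].
Proof.
exists z; split.
- apply: (@schauder_basic_grunblum R p p1 z 61) => //.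
  + by move=> j; exact: Lp_zb.
  + by move=> j; rewrite gt_eqF// zb_norm_gt0.
  (* Blocks are non-empty, so the first [n] of them hold at least [n] vectors. *)
  + move=> a m n mn; have nJ := leq_offset sz_gt0 n.
    by rewrite (z_cut a mn nJ) (z_full a nJ) blocks_cut_le.
- by move=> j x; exact: zb_ge0.
move=> a n; exists (offset sz n).
pose b k := let j := block_index sz_gt0 k in
  a j * (if odd (k - offset sz j) then - L j else 1).
exists b; apply/funext => x; rewrite lincomb_offset; apply: eq_bigr => j _.
rewrite -block_basis_vector mulr_sumr; apply: eq_bigr => i _.
by rewrite /b block_index_offset// addKn mulrA.
Qed.

End Blocks.

(** * An isometry of L_p onto the functions vanishing on ]0, 1] *)

Definition gap_shift (R : realType) (f : R -> R) : R -> R :=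
  fun x => if x <= 0 then f x else if 1 < x then f (x - 1) else 0.

Section GapShift.
Variables (R : realType) (p : R).
Hypothesis p1 : 1 < p.
Local Notation mu := (@lebesgue_measure R).
Local Notation N := (Lpnorm p).

Let p0 : 0 < p. Proof. exact: lt_trans p1. Qed.

Lemma Lp_indicM (f : R -> R) (A : set R) : measurable A -> Lp p f ->
  Lp p (fun x => \1_A x * f x).
Proof.
move=> mA lf; apply: (Lp_le p1 _ lf).
  by apply: measurable_funM; [exact: measurable_indic|case: lf].
move=> x; rewrite indicE; case: (x \in A); rewrite ?mul1r// mul0r normr0//.
Qed.

(** Translation invariance: the image of Lebesgue measure under the translation agrees with it on
    half-open intervals, hence everywhere by uniqueness. *)
Let shiftN (g : R -> R) : Lp p g ->
  Lp p (fun x => g (x - 1)) /\ N (fun x => g (x - 1)) = N g.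
Proof.
move=> lg; have mg : measurable_fun setT g by case: lg.
pose phi : R -> measurableTypeR R := fun x => x - 1.
have mphi : measurable_fun setT (fun x : R => x - 1 : R) by exact: measurable_funB.
have mf : measurable_fun setT (fun x : R => g (x - 1)) by exact: measurableT_comp.
have mG : measurable_fun setT (fun x : R => `|g x| `^ p).
  exact: measurable_norm_powR.
have E : (\int[mu]_x (`|g (x - 1)| `^ p)%:E = \int[mu]_x (`|g x| `^ p)%:E)%E.
  transitivity (\int[pushforward mu phi]_(x in (setT : set (measurableTypeR R)))
      (`|g (x : R)| `^ p)%:E)%E.
    rewrite ge0_integral_pushforward//.
    by apply/measurable_EFinP.
  apply: eq_measure_integral => A mA _.
  apply/esym/lebesgue_measure_unique => //= _ [[a b]] _ <-.
  rewrite /pushforward (_ : phi @^-1` _ = `](a + 1), (b + 1)]%classic); last first.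
    apply/seteqP; split=> x /=; rewrite !in_itv/= /phi; lra.
  rewrite !lebesgue_measure_itv/= !lte_fin ltrD2r; case: ifP => // _.
  by rewrite -!EFinD; congr EFin; ring.
have lf : Lp p (fun x => g (x - 1)).
  by apply: Lp_intP => //; rewrite E Lp_int_lty.
split=> //; apply/eqP; rewrite eq_le; apply/andP; split;
  apply: (powR_le_inv p0); rewrite ?Lpnorm_ge0//;
  by rewrite -lee_fin !LpnormXE// E.
Qed.

(** Both [f] and its shift are sums of two disjointly supported pieces, one on each side of the cut,
    and the pieces have equal norms. *)
Lemma Lp_gap_shift (f : R -> R) : Lp p f ->
  Lp p (gap_shift f) /\ N (gap_shift f) = N f.
Proof.
move=> lf.
pose f1 x := \1_(`]-oo, 0]%classic : set R) x * f x.
pose f2 x := \1_(`]0, +oo[%classic : set R) x * f x.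
have l1 : Lp p f1 by exact: Lp_indicM.
have l2 : Lp p f2 by exact: Lp_indicM.
have [l3 n3] := shiftN l2.
have i1 x : \1_(`]-oo, 0]%classic : set R) x = (x <= 0)%R%:R :> R.
  by rewrite indicE mem_setE in_itv.
have i2 x : \1_(`]0, +oo[%classic : set R) x = (0 < x)%R%:R :> R.
  by rewrite indicE mem_setE in_itv/= andbT.
have E : gap_shift f = fun x => f1 x + f2 (x - 1).
  apply/funext => x; rewrite /gap_shift /f1 /f2 i1 i2 subr_gt0.
  have [x0|x0] := leP x 0; last by rewrite mul0r add0r; case: ltP; rewrite ?mul1r ?mul0r.
  rewrite (_ : 1 < x = false) ?mul0r ?addr0 ?mul1r//.
  by apply/negbTE; rewrite -leNgt (le_trans x0).
have F : f = fun x => f1 x + f2 x.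
  apply/funext => x; rewrite /f1 /f2 i1 i2.
  by have [x0|x0] := leP x 0; rewrite !(mul0r, mul1r, addr0, add0r).
split; first by rewrite E; exact: LpD.
have G : N (gap_shift f) `^ p = N f `^ p.
  rewrite [in RHS]F [in LHS]E !LpnormX_disjoint// ?n3// => x.
    by rewrite /f1 /f2 i1 i2; have [x0|x0] := leP x 0; rewrite !(mul0r, mulr0).
  rewrite /f1 /f2 i1 i2 subr_gt0; have [x0|x0] := leP x 0; rewrite ?mul0r//.
  by rewrite (_ : 1 < x = false) ?mul0r ?mulr0// ; apply/negbTE; rewrite -leNgt (le_trans x0).
by apply/eqP; rewrite eq_le; apply/andP; split;
  apply: (powR_le_inv p0); rewrite ?Lpnorm_ge0// G.
Qed.

End GapShift.

(** * Haar functions for an arbitrary sequence of breakpoints *)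

Section ThreePieces.
Variables (R : realType) (p : R).
Hypothesis p1 : 1 < p.
Local Notation N := (Lpnorm p).
Let p0 : 0 < p. Proof. exact: lt_trans p1. Qed.

Definition ioc_indic (a b : R) : R -> R := fun s => ((a < s) && (s <= b))%:R.

Lemma ioc_indicE a b : ioc_indic a b = \1_(`]a, b]%classic : set R).
Proof. by apply/funext => s; rewrite indicE mem_setE in_itv. Qed.

Lemma LpnormX_ioc (c a b : R) : a < b ->
  Lp p (fun x => c * ioc_indic a b x) /\
  N (fun x => c * ioc_indic a b x) `^ p = `|c| `^ p * (b - a).
Proof.
move=> ab; rewrite ioc_indicE.
have [] := @LpnormX_indic R p p1 c `]a, b]%classic.
- exact: measurable_itv.
- by rewrite lebesgue_measure_itv/= lte_fin ab -EFinB ltry.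
by move=> l ->; split=> //; rewrite lebesgue_measure_itv/= lte_fin ab -EFinB.
Qed.

Lemma Lp_ioc a b : a < b -> Lp p (ioc_indic a b).
Proof.
move=> ab; have [l _] := LpnormX_ioc 1 ab.
by rewrite (_ : ioc_indic a b = fun x => 1 * ioc_indic a b x)//; apply/funext => x; rewrite mul1r.
Qed.

(** The perturbation has mean zero on an interval where [x] is the constant [k]. The subgradient of
    [|.|^p] at [k] bounds the two changes below by [g * t] and [- g * t], which cancel. *)
Lemma split_interval_le (x : R -> R) (a b c k t : R) : Lp p x -> a < b -> b < c ->
  (forall s, a < s -> s <= c -> x s = k) ->
  N x <= N (fun s => x s + t * (ioc_indic a b s / (b - a) - ioc_indic b c s / (c - b))).
Proof.
move=> lx ab bc xk.
have ac := lt_trans ab bc.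
pose y s := x s - k * ioc_indic a c s.
have ly : Lp p y by apply: LpB => //; apply: LpZ => //; exact: Lp_ioc.
have y0 s : a < s -> s <= c -> y s = 0.
  by move=> h1 h2; rewrite /y xk// /ioc_indic h1 h2 mulr1 subrr.
have E u v : N (fun s => y s + u * ioc_indic a b s + v * ioc_indic b c s) `^ p =
    N y `^ p + `|u| `^ p * (b - a) + `|v| `^ p * (c - b).
  have [l1 n1] := LpnormX_ioc u ab; have [l2 n2] := LpnormX_ioc v bc.
  rewrite (@LpnormX_disjoint _ _ p1 (fun s => y s + u * ioc_indic a b s))//; last 2 first.
  - exact: LpD.
  - move=> s; rewrite /ioc_indic; have [bs|sb] := ltP b s; last by rewrite !mulr0.
    have [sc|cs] := leP s c; last by rewrite !mulr0.
    by rewrite y0 ?(lt_trans ab)//= ?andbF ?mulr0 ?addr0 ?mul0r.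
  rewrite LpnormX_disjoint ?n1 ?n2// => s.
  rewrite /ioc_indic; have [sa|sa] := ltP a s; last by rewrite !mulr0.
  have [sb|bs] := leP s b; last by rewrite !mulr0.
  by rewrite y0 ?mul0r// (le_trans sb)// ltW.
have split_ac s : ioc_indic a c s = ioc_indic a b s + ioc_indic b c s.
  rewrite /ioc_indic; have [bs|sb] := ltP b s.
    by rewrite (lt_trans ab bs)/= ?andbF add0r.
  by rewrite (le_trans sb (ltW bc)) !andbT addr0.
rewrite (_ : x = fun s => y s + k * ioc_indic a b s + k * ioc_indic b c s); last first.
  by apply/funext => s; rewrite /y split_ac; ring.
rewrite [leRHS](_ : _ = N (fun s => y s + (k + t / (b - a)) * ioc_indic a b s +
    (k - t / (c - b)) * ioc_indic b c s)); last first.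
  by congr (N _); apply/funext => s; ring.
apply: (powR_le_inv p0); rewrite ?Lpnorm_ge0// !E -!addrA lerD2l.
have [g gP] := @normr_powR_subgradient R p k p1.
have ba : 0 < b - a by rewrite subr_gt0.
have cb : 0 < c - b by rewrite subr_gt0.
have h1 : `|k| `^ p * (b - a) + g * t <= `|k + t / (b - a)| `^ p * (b - a).
  rewrite (_ : _ + _ = (`|k| `^ p + g * (k + t / (b - a) - k)) * (b - a)).
    by rewrite ler_pM2r.
  by field; rewrite gt_eqF.
have h2 : `|k| `^ p * (c - b) - g * t <= `|k - t / (c - b)| `^ p * (c - b).
  rewrite (_ : _ - _ = (`|k| `^ p + g * (k - t / (c - b) - k)) * (c - b)).
    by rewrite ler_pM2r.
  by field; rewrite gt_eqF.
by move: (lerD h1 h2); rewrite addrACA subrr addr0.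
Qed.

End ThreePieces.

Section StepSpaces.
Variables (R : realType) (p : R).
Hypothesis p1 : 1 < p.
Local Notation N := (Lpnorm p).
Let p0 : 0 < p. Proof. exact: lt_trans p1. Qed.

Variable q : nat -> R.

Definition same_cell (j : nat) (s t : R) :=
  forall i, (i <= j)%N -> (q i < s) = (q i < t).

(** Step functions with breakpoints [q 0], ..., [q j], vanishing on both unbounded cells. The space
    for [j = 0] is zero, which starts the inductions. *)
Definition step_space (j : nat) (x : R -> R) :=
  [/\ forall s t, same_cell j s t -> x s = x t,
      forall s, (forall i, (i <= j)%N -> q i < s) -> x s = 0 &
      forall s, (forall i, (i <= j)%N -> s <= q i) -> x s = 0].

Lemma step_spaceB j (x y : R -> R) (t : R) :
  step_space j x -> step_space j y -> step_space j (fun s => x s - t * y s).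
Proof.
move=> [x1 x2 x3] [y1 y2 y3]; split=> [s u su|s hs|s hs].
- by rewrite (x1 s u su) (y1 s u su).
- by rewrite x2// y2// mulr0 subr0.
- by rewrite x3// y3// mulr0 subr0.
Qed.

Lemma step_spaceZ j (x : R -> R) (t : R) :
  step_space j x -> step_space j (fun s => t * x s).
Proof.
move=> [x1 x2 x3]; split=> [s u su|s hs|s hs].
- by rewrite (x1 s u su).
- by rewrite x2// mulr0.
- by rewrite x3// mulr0.
Qed.

Lemma step_spaceS j (x : R -> R) : step_space j x -> step_space j.+1 x.
Proof.
move=> [x1 x2 x3]; split=> [s u su|s hs|s hs].
- by apply: x1 => i ij; apply: su; exact: leqW.
- by apply: x2 => i ij; apply: hs; exact: leqW.
- by apply: x3 => i ij; apply: hs; exact: leqW.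
Qed.

(** The neighbour is the largest of the breakpoints below [c], updated as each breakpoint is
    added. *)
Lemma exists_left_neighbour j c : (forall i, (i <= j)%N -> q i != c) ->
  (forall i, (i <= j)%N -> c < q i) \/
  exists l, [/\ (l <= j)%N, q l < c &
    forall i, (i <= j)%N -> q i <= q l \/ c < q i].
Proof.
elim: j => [|j ih] qc.
  have [lt0|gt0|e] := ltgtP (q 0%N) c.
  - by right; exists 0%N; split=> // i; rewrite leqn0 => /eqP ->; left.
  - by left=> i; rewrite leqn0 => /eqP ->.
  - by move: (qc 0%N isT); rewrite e eqxx.
have [|h|[l [lj lc lmax]]] := ih; first by move=> i ij; apply: qc; exact: leqW.
  have [ltj|gtj|e] := ltgtP (q j.+1) c.
  - right; exists j.+1; split=> // i; rewrite leq_eqVlt => /predU1P[->|]; first by left.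
    by rewrite ltnS => /h; right.
  - left=> i; rewrite leq_eqVlt => /predU1P[->//|]; rewrite ltnS; exact: h.
  - by move: (qc j.+1 (leqnn _)); rewrite e eqxx.
right; have [ltj|gtj|e] := ltgtP (q j.+1) c.
- have [jl|lj'] := leP (q j.+1) (q l).
    exists l; split=> //; first exact: leqW.
    by move=> i; rewrite leq_eqVlt => /predU1P[->|]; [left|rewrite ltnS; exact: lmax].
  exists j.+1; split=> // i; rewrite leq_eqVlt => /predU1P[->|]; first by left.
  rewrite ltnS => /lmax[il|]; last by right.
  by left; rewrite (le_trans il)// ltW.
- exists l; split=> //; first exact: leqW.
  by move=> i; rewrite leq_eqVlt => /predU1P[->|]; [right|rewrite ltnS; exact: lmax].
- by move: (qc j.+1 (leqnn _)); rewrite e eqxx.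
Qed.

End StepSpaces.

Section HaarStep.
Variables (R : realType) (p : R).
Hypothesis p1 : 1 < p.
Local Notation N := (Lpnorm p).
Let p0 : 0 < p. Proof. exact: lt_trans p1. Qed.

Lemma exists_right_neighbour (q : nat -> R) j c : (forall i, (i <= j)%N -> q i != c) ->
  (forall i, (i <= j)%N -> q i < c) \/
  exists l, [/\ (l <= j)%N, c < q l &
    forall i, (i <= j)%N -> q i < c \/ q l <= q i].
Proof.
move=> qc; have [|h|[l [lj lc lmax]]] := @exists_left_neighbour R (fun i => - q i) j (- c).
- by move=> i ij; rewrite eqr_opp qc.
- by left=> i ij; rewrite -ltrN2 h.
right; exists l; split=> //; first by rewrite -ltrN2.
by move=> i /lmax; rewrite lerN2 ltrN2 => -[]; [right|left].
Qed.

Variable q : nat -> R.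
Hypothesis q_inj : injective q.

Lemma Lpnorm_ioc_neq0 c a b : c != 0 -> a < b -> 0 < N (fun x => c * ioc_indic a b x).
Proof.
move=> c0 ab; have [_ n] := LpnormX_ioc p1 c ab.
rewrite lt_neqAle Lpnorm_ge0 andbT; apply/eqP => e.
move: n; rewrite -e powR0 ?gt_eqF// => /esym/eqP.
by rewrite gt_eqF// mulr_gt0 ?powR_gt0 ?normr_gt0 ?subr_gt0.
Qed.

(** The fourth clause is Birkhoff orthogonality of the old step space to [h], the source of
    monotonicity; the fifth says that [h] spans what the new breakpoint adds. *)
Definition haar_like (j : nat) (h : R -> R) :=
  [/\ step_space q j.+1 h, Lp p h, 0 < N h,
    (forall x, Lp p x -> step_space q j x -> forall t, N x <= N (fun s => x s + t * h s)) &
    (forall x, step_space q j.+1 x -> exists t, step_space q j (fun s => x s - t * h s))].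

Lemma exists_haar_like j : exists h, haar_like j h.
Proof.
pose c := q j.+1.
have qc i : (i <= j)%N -> q i != c.
  by move=> ij; apply/eqP => /q_inj e; rewrite e ltnn in ij.
have leS i : (i <= j.+1)%N -> i = j.+1 \/ (i <= j)%N.
  by rewrite leq_eqVlt => /predU1P[|]; [left|right].
(* If the new breakpoint [c] lies to the left of all others, [h] is the indicator of the new bounded
   cell, disjoint from the old step functions. *)
case: (exists_left_neighbour qc) => [c_lt|[l [lj lc lmax]]].
  case: (exists_right_neighbour qc) => [lt_c|[u [uj cu umin]]].
    by have := lt_trans (c_lt 0%N isT) (lt_c 0%N isT); rewrite ltxx.
  have uq i : (i <= j)%N -> q u <= q i.
    by move=> ij; case: (umin i ij) => // ic; have := lt_trans ic (c_lt i ij); rewrite ltxx.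
  exists (ioc_indic c (q u)); split.
  - split=> [s t st|s hs|s hs].
    + by rewrite /ioc_indic !leNgt -/c (st j.+1 (leqnn _)) (st u (leqW uj)).
    + by rewrite /ioc_indic [_ <= q u]leNgt (hs u (leqW uj)) andbF.
    + by rewrite /ioc_indic [_ < s]ltNge (hs j.+1 (leqnn _)).
  - exact: Lp_ioc.
  - have := @Lpnorm_ioc_neq0 1 c (q u) (oner_neq0 _) cu.
    by rewrite (_ : (fun x => _) = ioc_indic c (q u))//; apply/funext => x; rewrite mul1r.
  - move=> x lx [x1 x2 x3] t.
    apply: Lpnorm_disjoint_le => //; first by apply: LpZ => //; exact: Lp_ioc.
    move=> s; rewrite /ioc_indic; have [cs|sc] := ltP c s; last by rewrite !mulr0.
    have [su|us] := leP s (q u); last by rewrite !mulr0.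
    by rewrite x3 ?mul0r// => i ij; rewrite (le_trans su)// uq.
  - move=> x [x1 x2 x3]; exists (x (q u)).
    have onI s : c < s -> s <= q u -> x s = x (q u).
      move=> cs su; apply: x1 => i /leS[->|ij]; first by rewrite cs cu.
      by rewrite !ltNge (le_trans su (uq _ ij)) uq.
    split=> [s t st|s hs|s hs].
    + wlog : s t st / s <= t.
        move=> H; have [|ts] := leP s t; first exact: H.
        by apply/esym/H; [move=> i /st|exact: ltW].
      move=> le_st; have [cs|sc] := ltP c s.
        have ct := lt_le_trans cs le_st.
        rewrite (x1 s t) => [|i /leS[->|]]; [|by rewrite cs ct|exact: st].
        by rewrite /ioc_indic cs ct /= !leNgt (st u uj).
      have [ct|tc] := ltP c t.
        have := st u uj; rewrite [X in X = _]ltNge (le_trans sc (ltW cu)) => /esym/negbT.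
        rewrite -leNgt => tu.
        rewrite (onI t ct tu) /ioc_indic ct tu mulr1 subrr ltNge sc mulr0 subr0.
        apply: x3 => i /leS[->//|ij]; exact: le_trans sc (ltW (c_lt _ ij)).
      rewrite (x1 s t) => [|i /leS[->|]]; [|by rewrite !ltNge sc tc|exact: st].
      by rewrite /ioc_indic !ltNge sc tc.
    + rewrite x2 => [|i /leS[->|ij]]; [|exact: lt_trans cu (hs _ uj)|exact: hs].
      by rewrite /ioc_indic [_ <= q u]leNgt (hs u uj) andbF mulr0 subr0.
    + have [cs|sc] := ltP c s.
        by rewrite onI ?hs// /ioc_indic cs hs// mulr1 subrr.
      rewrite x3 => [|i /leS[->//|]]; last exact: hs.
      by rewrite /ioc_indic ltNge sc mulr0 subr0.
(* The mirror case, with [c] to the right of all others. *)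
case: (exists_right_neighbour qc) => [lt_c|[u [uj cu umin]]].
  have ql i : (i <= j)%N -> q i <= q l.
    by move=> ij; case: (lmax i ij) => // ic; have := lt_trans ic (lt_c i ij); rewrite ltxx.
  exists (ioc_indic (q l) c); split.
  - split=> [s t st|s hs|s hs].
    + by rewrite /ioc_indic !leNgt -/c (st j.+1 (leqnn _)) (st l (leqW lj)).
    + by rewrite /ioc_indic [_ <= c]leNgt (hs j.+1 (leqnn _)) andbF.
    + by rewrite /ioc_indic [_ < s]ltNge (hs l (leqW lj)).
  - exact: Lp_ioc.
  - have := @Lpnorm_ioc_neq0 1 (q l) c (oner_neq0 _) lc.
    by rewrite (_ : (fun x => _) = ioc_indic (q l) c)//; apply/funext => x; rewrite mul1r.
  - move=> x lx [x1 x2 x3] t.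
    apply: Lpnorm_disjoint_le => //; first by apply: LpZ => //; exact: Lp_ioc.
    move=> s; rewrite /ioc_indic; have [ls|sl] := ltP (q l) s; last by rewrite !mulr0.
    by rewrite x2 ?mul0r// => i ij; rewrite (le_lt_trans _ ls)// ql.
  - move=> x [x1 x2 x3]; exists (x c).
    have onI s : q l < s -> s <= c -> x s = x c.
      move=> ls sc; apply: x1 => i /leS[->|ij]; first by rewrite ltxx ltNge sc.
      by rewrite (le_lt_trans (ql _ ij) ls) lt_c.
    split=> [s t st|s hs|s hs].
    + wlog : s t st / s <= t.
        move=> H; have [|ts] := leP s t; first exact: H.
        by apply/esym/H; [move=> i /st|exact: ltW].
      move=> le_st; have [cs|sc] := ltP c s.
        have ct := lt_le_trans cs le_st.
        rewrite (x1 s t) => [|i /leS[->|]]; [|by rewrite cs ct|exact: st].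
        by rewrite /ioc_indic !leNgt cs ct !andbF.
      have [ct|tc] := ltP c t.
        have := st l lj; rewrite [X in _ = X](lt_trans lc ct) => ls.
        rewrite (onI s ls sc) /ioc_indic ls sc mulr1 subrr leNgt ct andbF mulr0 subr0.
        apply/esym/x2 => i /leS[->//|ij]; exact: lt_trans (lt_c _ ij) ct.
      rewrite (x1 s t) => [|i /leS[->|]]; [|by rewrite !ltNge sc tc|exact: st].
      by rewrite /ioc_indic sc tc (st l lj).
    + have [cs|sc] := ltP c s.
        rewrite x2 => [|i /leS[->//|]]; last exact: hs.
        by rewrite /ioc_indic leNgt cs andbF mulr0 subr0.
      by rewrite onI ?hs// /ioc_indic sc hs// mulr1 subrr.
    + rewrite x3 => [|i /leS[->|]]; [|exact: le_trans (hs _ lj) (ltW lc)|exact: hs].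
      by rewrite /ioc_indic ltNge (hs l lj) mulr0 subr0.
(* Now [c] splits a bounded cell in two, and [h] is the mean-zero function on the two halves. *)
exists (fun s => ioc_indic (q l) c s / (c - q l) - ioc_indic c (q u) s / (q u - c)).
have cl0 : 0 < c - q l by rewrite subr_gt0.
have uc0 : 0 < q u - c by rewrite subr_gt0.
set h := fun s => _.
have hS : step_space q j.+1 h.
  split=> [s t st|s hs|s hs].
  + by rewrite /h /ioc_indic !leNgt -/c (st j.+1 (leqnn _)) (st l (leqW lj)) (st u (leqW uj)).
  + rewrite /h /ioc_indic [_ <= c]leNgt [_ <= q u]leNgt -/c (hs j.+1 (leqnn _)) (hs u (leqW uj)).
    by rewrite !andbF !mul0r subrr.
  + rewrite /h /ioc_indic [q l < s]ltNge [c < s]ltNge -/c (hs j.+1 (leqnn _)) (hs l (leqW lj)).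
    by rewrite !mul0r subrr.
have l1 : Lp p (fun s => (c - q l)^-1 * ioc_indic (q l) c s) by exact/LpZ/Lp_ioc.
have l2 : Lp p (fun s => - (q u - c)^-1 * ioc_indic c (q u) s) by exact/LpZ/Lp_ioc.
have hE : h = fun s => (c - q l)^-1 * ioc_indic (q l) c s + - (q u - c)^-1 * ioc_indic c (q u) s.
  by apply/funext => s; rewrite /h; ring.
split=> //.
- by rewrite hE; exact: LpD.
- apply: (@lt_le_trans _ _ (N (fun s => (c - q l)^-1 * ioc_indic (q l) c s))).
    by apply: Lpnorm_ioc_neq0; rewrite // invr_neq0// gt_eqF.
  rewrite hE; apply: Lpnorm_disjoint_le => // s.
  by rewrite /ioc_indic; have [cs|sc] := ltP c s; rewrite ?andbF ?mulr0 ?mul0r.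
- move=> x lx [x1 x2 x3] t.
  apply: (split_interval_le p1 (k := x (q u))) => // s ls su; apply: x1 => i ij.
  case: (lmax i ij) => [il|ci].
    by rewrite (le_lt_trans il ls) (le_lt_trans il (lt_trans lc cu)).
  have ui : q u <= q i by case: (umin i ij) => // ic; have := lt_trans ic ci; rewrite ltxx.
  by rewrite !ltNge ui (le_trans su ui).
move=> x xS; have [x1 x2 x3] := xS.
(* The jump of [x] at [c] divided by that of [h], so that [x - t * h] takes the same value on the
   two halves. *)
pose t := (x c - x (q u)) / ((c - q l)^-1 + (q u - c)^-1).
have tE : x c - t / (c - q l) = x (q u) + t / (q u - c).
  rewrite /t; field; rewrite !gt_eqF//=.
  by rewrite addr_gt0.
have hl s : q l < s -> s <= c -> x s - t * h s = x c - t / (c - q l).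
  move=> ls sc; rewrite (x1 s c); last first.
    move=> i /leS[->|ij]; first by rewrite ltxx ltNge sc.
    case: (lmax i ij) => [il|ci]; first by rewrite (le_lt_trans il ls) (le_lt_trans il lc).
    by rewrite !ltNge (ltW ci) (le_trans sc (ltW ci)).
  by rewrite /h /ioc_indic ls sc [c < s]ltNge sc mul0r subr0 mul1r.
have hr s : c < s -> s <= q u -> x s - t * h s = x c - t / (c - q l).
  move=> cs su; rewrite (x1 s (q u)); last first.
    move=> i /leS[->|ij]; first by rewrite cs cu.
    case: (umin i ij) => [ic|ui]; first by rewrite (lt_trans ic cs) (lt_trans ic cu).
    by rewrite !ltNge ui (le_trans su ui).
  by rewrite /h /ioc_indic cs su [s <= c]leNgt cs andbF mul0r sub0r mul1r mulrN opprK tE.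
exists t; have yS := step_spaceB t xS hS; have [y1 y2 y3] := yS.
split=> [s s' st|s hs|s hs].
- wlog : s s' st / s <= s'.
    move=> H; have [|ts] := leP s s'; first exact: H.
    by apply/esym/H; [move=> i /st|exact: ltW].
  move=> le_st; have [cs|sc] := ltP c s.
    apply: y1 => i /leS[->|]; last exact: st.
    by rewrite cs (lt_le_trans cs le_st).
  have [ct|tc] := ltP c s'; last first.
    by apply: y1 => i /leS[->|]; [rewrite !ltNge sc tc|exact: st].
  have := st l lj; rewrite [X in _ = X](lt_trans lc ct) => ls.
  have := st u uj; rewrite [X in X = _]ltNge (le_trans sc (ltW cu)) => /esym/negbT.
  rewrite -leNgt => tu.
  by rewrite hl// hr.
- by apply: y2 => i /leS[->|]; [exact: lt_trans cu (hs _ uj)|exact: hs].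
- by apply: y3 => i /leS[->|]; [exact: le_trans (hs _ lj) (ltW lc)|exact: hs].
Qed.

End HaarStep.

Lemma exists_dense_injective_sequence (R : realType) :
  exists q : nat -> R, injective q /\ forall a b, a < b -> exists n, a < q n < b.
Proof.
have /card_set_bijP[f [_ finj fsurj]] : ([set: nat] #= [set: rat])%card by apply/card_esym/card_rat.
exists (fun n => ratr (f n)); split=> [m n /(fmorph_inj (@ratr R)) mn|a b ab].
  by apply: finj; rewrite ?inE.
have [r] := rat_in_itvoo ab; rewrite in_itv/= => rab.
by have [n _ nr] := fsurj r I; exists n; rewrite nr.
Qed.

(** * Density of the step functions in L_p *)

Section StepDensity.
Variables (R : realType) (p : R).
Hypothesis p1 : 1 < p.
Local Notation N := (Lpnorm p).
Local Notation mu := (@lebesgue_measure R).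
Let p0 : 0 < p. Proof. exact: lt_trans p1. Qed.

Variable q : nat -> R.
Hypothesis q_dense : forall a b, a < b -> exists n, a < q n < b.
Hypothesis step_Lp : forall j x, step_space q j x -> Lp p x.

Definition step_approx (f : R -> R) := Lp p f /\ forall e, 0 < e ->
  exists j x, step_space q j x /\ N (fun s => f s - x s) < e.

Lemma step_space_le j k x : (j <= k)%N -> step_space q j x -> step_space q k x.
Proof.
by move=> /subnK <-; elim: (k - j)%N => // n ih /ih; rewrite addSn; exact: step_spaceS.
Qed.

Lemma step_approxB (f g : R -> R) : step_approx f -> step_approx g ->
  step_approx (fun s => f s - g s).
Proof.
move=> [lf af] [lg ag]; split=> [|e e0]; first exact: LpB.
have e20 : 0 < e / 2 by rewrite divr_gt0.
have [j [x [xS fx]]] := af _ e20; have [k [y [yS gy]]] := ag _ e20.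
exists (maxn j k), (fun s => x s - 1 * y s); split.
  by apply: step_spaceB; [apply: step_space_le xS|apply: step_space_le yS];
    rewrite ?leq_maxl ?leq_maxr.
have lx := step_Lp xS; have ly := step_Lp yS.
rewrite (_ : (fun s => _) = fun s => (f s - x s) - (g s - y s)); last first.
  by apply/funext => s; ring.
apply: le_lt_trans (LpnormB p1 (LpB p1 lf lx) (LpB p1 lg ly)) _.
by rewrite [ltRHS](splitr e) ltrD.
Qed.

Lemma step_approxZ (f : R -> R) c : step_approx f -> step_approx (fun s => c * f s).
Proof.
move=> [lf af]; split=> [|e e0]; first exact: LpZ.
have [j [x [xS fx]]] := af (e / (`|c| + 1)) (divr_gt0 e0 (ltr_wpDl (normr_ge0 c) ltr01)).
exists j, (fun s => c * x s); split; first exact: step_spaceZ.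
rewrite (_ : (fun s => _) = fun s => c * (f s - x s)); last first.
  by apply/funext => s; ring.
rewrite LpnormZ//; last exact: LpB (step_Lp xS).
move: fx; rewrite ltr_pdivlMr; last by rewrite ltr_wpDl.
by apply: le_lt_trans; rewrite mulrC ler_wpM2l ?Lpnorm_ge0// lerDl.
Qed.

Lemma step_approx0 : step_approx (fun=> 0).
Proof.
split=> [|e e0]; first exact: Lp0.
exists 0%N, (fun=> 0); split; first by split.
by rewrite (_ : (fun s => _) = fun=> 0) ?Lpnorm0//; apply/funext => s; rewrite subr0.
Qed.

Lemma step_approxD (f g : R -> R) : step_approx f -> step_approx g ->
  step_approx (fun s => f s + g s).
Proof.
move=> af ag; rewrite (_ : (fun s => _) = fun s => f s - (-1) * g s).
  by apply: step_approxB => //; exact: step_approxZ.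
by apply/funext => s; rewrite mulN1r opprK.
Qed.

Lemma step_approx_sum (I : Type) (r : seq I) (P : pred I) (F : I -> R -> R) :
  (forall i, P i -> step_approx (F i)) ->
  step_approx (fun x => \sum_(i <- r | P i) F i x).
Proof.
move=> aF; elim: r => [|i r ih].
  by under eq_fun do rewrite big_nil; exact: step_approx0.
under eq_fun do rewrite big_cons.
case: (boolP (P i)) => Pi; last exact: ih.
by apply: step_approxD => //; exact: aF.
Qed.

Lemma step_approx_closed (f : R -> R) : Lp p f ->
  (forall e, 0 < e -> exists g, step_approx g /\ N (fun s => f s - g s) < e) ->
  step_approx f.
Proof.
move=> lf af; split=> // e e0; have e20 : 0 < e / 2 by rewrite divr_gt0.
have [g [[lg ag] fg]] := af _ e20; have [j [x [xS gx]]] := ag _ e20.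
exists j, x; split=> //.
rewrite (_ : (fun s => _) = fun s => (f s - g s) + (g s - x s)); last first.
  by apply/funext => s; ring.
apply: le_lt_trans (LpnormD p1 (LpB p1 lf lg) (LpB p1 lg (step_Lp xS))) _.
by rewrite [ltRHS](splitr e) ltrD.
Qed.

Lemma step_approx_dominated (f_ : nat -> R -> R) (f g : R -> R) :
  (forall n, step_approx (f_ n)) -> Lp p f -> Lp p g ->
  (forall x, f_ ^~ x @ \oo --> f x) ->
  (forall n x, `|f_ n x - f x| <= `|g x|) -> step_approx f.
Proof.
move=> af lf lg f_f fg; apply: step_approx_closed => // e e0.
have : (fun n => N (fun x => f_ n x - f x)) @ \oo --> 0.
  by apply: (Lpnorm_dominated_cvg p1 _ lf lg) => // n; case: (af n) => -[].
move=> /cvgrPdist_lt /(_ _ e0)[n _ /(_ n (leqnn n))] /=.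
rewrite sub0r normrN ger0_norm ?Lpnorm_ge0// => h.
by exists (f_ n); split=> //; rewrite Lpnorm_distC//; case: (af n).
Qed.

Lemma step_approx_open (U : set R) : open U -> (mu U < +oo)%E ->
  step_approx (\1_U : R -> R).
Proof.
move=> oU Uoo; have mU : measurable U by exact: open_measurable.
have lU : Lp p (\1_U : R -> R).
  have [l _] := LpnormX_indic p1 1 mU Uoo.
  by rewrite (_ : \1_U = fun x => 1 * \1_U x)//; apply/funext => x; rewrite mul1r.
(* The set of these [s] is the union of the intervals []q i, q k]] inside [U] with [i, k <= n]. By
   density of [q] these unions exhaust the open set. *)
pose good n s := [exists i : 'I_n.+1, exists k : 'I_n.+1,
  [&& `[< `]q i, q k]%classic `<=` U >], q i < s & s <= q k]].
have goodU n s : good n s -> s \in U.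
  move=> /existsP[i /existsP[k /and3P[/asboolP h is_ sk]]].
  by rewrite inE; apply: h; rewrite /= in_itv/= is_.
have goodS n : step_space q n (fun s => (good n s)%:R).
  split=> [s t st|s hs|s hs].
  - congr ((_ : bool)%:R); apply: eq_existsb => i; apply: eq_existsb => k.
    have ei : (q i < s) = (q i < t) by apply: st; rewrite -ltnS.
    have ek : (q k < s) = (q k < t) by apply: st; rewrite -ltnS.
    by rewrite ei [s <= _]leNgt [t <= _]leNgt ek.
  - rewrite (_ : good n s = false)//; apply/negbTE/existsP => -[i /existsP[k /and3P[_ _]]].
    have -> : (s <= q k) = false by rewrite leNgt hs// -ltnS.
    by [].
  - rewrite (_ : good n s = false)//; apply/negbTE/existsP => -[i /existsP[k /and3P[_]]].
    have -> : (q i < s) = false by rewrite ltNge hs// -ltnS.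
    by [].
apply: (@step_approx_dominated (fun n s => (good n s)%:R) _ (\1_U : R -> R)) => //.
- move=> n; split=> [|e e0]; first exact: step_Lp (goodS n).
  exists n, (fun s => (good n s)%:R); split=> //.
  by rewrite (_ : (fun s => _) = fun=> 0) ?Lpnorm0//; apply/funext => s; rewrite subrr.
- move=> s; rewrite indicE; case: (boolP (s \in U)) => sU; last first.
    rewrite (_ : (fun n => _) = fun=> 0); first exact: cvg_cst.
    apply/funext => n; case: (boolP (good n s)) => // /goodU.
    by rewrite (negbTE sU).
  move: oU; rewrite openE => /(_ s); rewrite inE in sU.
  move=> /(_ sU)[e /= e0 eU].
  have [i /andP[i1 i2]] : exists i, s - e < q i < s by apply: q_dense; rewrite ltrBlDr ltrDl.
  have [k /andP[k1 k2]] : exists k, s < q k < s + e by apply: q_dense; rewrite ltrDl.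
  apply: cvg_near_cst; exists (maxn i k) => // n /=; rewrite geq_max => /andP[ni nk].
  suff -> : good n s by [].
  have ni' : (i < n.+1)%N by []. have nk' : (k < n.+1)%N by [].
  apply/existsP; exists (Ordinal ni'); apply/existsP; exists (Ordinal nk').
  apply/and3P; split=> //=; last exact: ltW.
  apply/asboolP => t; rewrite /= in_itv/= => /andP[it tk]; apply: eU.
  by rewrite /ball_/= ltr_distlC; apply/andP; split; lra.
move=> n s; case: (boolP (good n s)) => [/goodU sU|_].
  by rewrite indicE sU subrr normr0.
by rewrite sub0r normrN.
Qed.

(** By outer regularity [A] is approximated by an open set [U], and the [p]-th power of the error is
    the measure of the difference of [U] and [A]. *)
Lemma step_approx_indic (A : set R) : measurable A -> (mu A < +oo)%E ->
  step_approx (\1_A : R -> R).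
Proof.
move=> mA Aoo.
have lI (B : set R) : measurable B -> (mu B < +oo)%E -> Lp p (\1_B : R -> R).
  move=> mB Boo; have [l _] := LpnormX_indic p1 1 mB Boo.
  by rewrite (_ : \1_B = fun x => 1 * \1_B x)//; apply/funext => x; rewrite mul1r.
apply: step_approx_closed => [|e e0]; first exact: lI.
have ep0 : 0 < e `^ p by rewrite powR_gt0.
have [U [oU AU UA]] := lebesgue_regularity_outer mA Aoo ep0.
have mU : measurable U by exact: open_measurable.
have mUA : measurable (U `\` A) by exact: measurableD.
have Uoo : (mu U < +oo)%E.
  rewrite -(setDUK AU) (le_lt_trans (measureU2 _ _ _))// lte_add_pinfty//.
  exact: lt_trans UA (ltry _).
have UAoo : (mu (U `\` A) < +oo)%E by exact: lt_trans UA (ltry _).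
exists (\1_U : R -> R); split; first exact: step_approx_open.
have [_ n] := LpnormX_indic p1 (-1) mUA UAoo.
rewrite (_ : (fun s => _) = fun s => -1 * \1_(U `\` A) s); last first.
  apply/funext => s; rewrite !indicE in_setD; case: (boolP (s \in A)) => sA /=.
    rewrite (_ : s \in U) ?andbF ?subrr ?mulr0//.
    by move: sA; rewrite !inE; exact: AU.
  by rewrite andbT sub0r mulN1r.
have {n} : N (fun s => -1 * \1_(U `\` A) s) `^ p < e `^ p.
  by rewrite n normrN normr1 powR1 mul1r -lte_fin fineK// ge0_fin_numE.
apply: contraTT; rewrite -!leNgt => eN.
by rewrite ge0_ler_powR ?nnegrE ?Lpnorm_ge0// ltW.
Qed.

(** Truncation to []- n, n]] handles sets of infinite measure, which occur with [c = 0] for the zero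
    value of a simple function. *)
Lemma step_approx_indicZ (A : set R) (c : R) : measurable A ->
  Lp p (fun x => c * \1_A x) -> step_approx (fun x => c * \1_A x).
Proof.
move=> mA lA.
pose B (n : nat) : set R := `]- n%:R, n%:R]%classic.
have mB n : measurable (A `&` B n) by apply: measurableI => //; exact: measurable_itv.
have Boo n : (mu (A `&` B n) < +oo)%E.
  apply: (@le_lt_trans _ _ (mu (B n))).
    by apply: le_measure; rewrite ?inE; [exact: mB|exact: measurable_itv|exact: subIsetr].
  by rewrite lebesgue_measure_itv/=; case: ifP => _; rewrite ?ltry// -EFinB ltry.
apply: (@step_approx_dominated (fun n x => c * \1_(A `&` B n) x) _ _ _ lA lA).
- by move=> n; apply: step_approxZ; exact: step_approx_indic.
- move=> x; apply: cvg_near_cst; exists (Num.truncn `|x|).+1 => // n /= xn.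
  congr (c * _); rewrite !indicE in_setI (_ : x \in B n) ?andbT//.
  have : `|x| < n%:R by apply: lt_le_trans (truncnS_gt _) _; rewrite ler_nat.
  by rewrite ltr_norml inE /B/= in_itv/= => /andP[-> /ltW].
move=> n x; rewrite !indicE in_setI; case: (x \in A); rewrite /= ?mulr0 ?subrr//.
by case: (x \in B n); rewrite /= ?subrr ?mulr0 ?sub0r ?normr0 ?normrN.
Qed.

Import HBNNSimple.

Lemma step_approx_ge0 (f : R -> R) : Lp p f -> (forall x, 0 <= f x) -> step_approx f.
Proof.
move=> lf f0; have mf : measurable_fun setT f by case: lf.
have mEf : measurable_fun setT (EFin \o f) by exact/measurable_EFinP.
pose g n := nnsfun_approx measurableT mEf n.
have g0 n x : 0 <= g n x by [].
have gf n x : g n x <= f x.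
  by rewrite -lee_fin /g nnsfun_approxE; apply: le_approx => //= y _; rewrite lee_fin.
apply: (@step_approx_dominated (fun n => g n) _ _ _ lf lf) => [n|x|n x]; last first.
- by rewrite distrC ger0_norm ?subr_ge0// ger0_norm// gerBl.
- have ge0 y : setT y -> (0 <= (EFin \o f) y)%E by rewrite lee_fin.
  by have /fine_cvgP[_] := cvg_nnsfun_approx measurableT mEf ge0 (I : setT x).
have lg : Lp p (g n) by apply: (Lp_le p1 _ lf) => // x; rewrite !ger0_norm.
rewrite (_ : (g n : R -> R) = fun x => \sum_(y <- finmap.enum_fset (fset_set (range (g n))))
    y * \1_(g n @^-1` [set y]) x); last first.
  by apply/funext => x; rewrite fimfunE fsbig_finite.
(* Each level of the simple function is dominated by the function itself, hence lies in L_p. *)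
apply: step_approx_sum => y _; apply: step_approx_indicZ => //.
apply: (Lp_le p1 _ lg) => [|x].
  by apply: measurable_funM => //; exact: measurable_indic.
rewrite indicE; case: (boolP (x \in _)) => [|_]; last by rewrite mulr0 normr0.
by rewrite inE/= => ->; rewrite mulr1.
Qed.

Lemma step_approx_Lp (f : R -> R) : Lp p f -> step_approx f.
Proof.
move=> lf; have mf : measurable_fun setT f by case: lf.
rewrite (_ : f = fun x => Num.max (f x) 0 - Num.max (- f x) 0); last first.
  apply/funext => x; case: (leP 0 (f x)) => fx.
    have Nfx : - f x <= 0 by rewrite oppr_le0.
    by rewrite (max_idPr Nfx) subr0.
  have Nfx : 0 <= - f x by rewrite oppr_ge0 ltW.
  by rewrite (max_idPl Nfx) opprK add0r.
apply: step_approxB; apply: step_approx_ge0.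
- apply: (Lp_le p1 _ lf) => [|x]; first exact: measurable_funrpos.
  by rewrite ger0_norm ?le_max ?lexx ?orbT// ge_max ler_norm normr_ge0.
- by move=> x; rewrite le_max lexx orbT.
- apply: (Lp_le p1 _ lf) => [|x]; first exact: measurable_funrneg.
  by rewrite ger0_norm ?le_max ?lexx ?orbT// ge_max -normrN ler_norm normr_ge0.
- by move=> x; rewrite le_max lexx orbT.
Qed.

End StepDensity.

(** * The normalized Haar system, the atoms and the conclusion *)

Lemma exists_haar_system (R : realType) (p : R) : 1 < p ->
  exists h : nat -> R -> R,
  [/\ forall j, Lp p (h j), forall j, Lpnorm p (h j) = 1,
    forall a m n, (m <= n)%N ->
      Lpnorm p (lincomb h a m) <= Lpnorm p (lincomb h a n) &
    forall f, Lp p f -> forall e, 0 < e ->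
      exists n a, Lpnorm p (fun s => f s - lincomb h a n s) < e].
Proof.
move=> p1; have [q [q_inj q_dense]] := exists_dense_injective_sequence R.
have /choice[g gP] := @exists_haar_like R p p1 q q_inj.
have g0 j : 0 < Lpnorm p (g j) by case: (gP j).
have gL j : Lp p (g j) by case: (gP j).
pose h j s := (Lpnorm p (g j))^-1 * g j s.
have hL j : Lp p (h j) by exact: LpZ.
have combS a j : step_space q j (lincomb h a j).
  elim: j => [|j ih]; first by split=> *; rewrite /lincomb !big_ord0.
  have [gS _ _ _ _] := gP j.
  rewrite (_ : lincomb h a j.+1 = fun s => lincomb h a j s -
      (- (a j * (Lpnorm p (g j))^-1)) * g j s); last first.
    by apply/funext => s; rewrite lincombS /h; ring.
  by apply: step_spaceB => //; exact: step_spaceS.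
have Scomb j x : step_space q j x -> exists a, x = lincomb h a j.
  elim: j x => [|j ih] x xS.
    exists (fun=> 0); apply/funext => s; rewrite /lincomb big_ord0.
    have [_ x2 x3] := xS; have [qs|sq] := ltP (q 0%N) s.
      by apply: x2 => i; rewrite leqn0 => /eqP ->.
    by apply: x3 => i; rewrite leqn0 => /eqP ->.
  have [_ _ _ _ gsplit] := gP j; have [t /ih[a xa]] := gsplit _ xS.
  (* The factor [Lpnorm p (g j)] undoes the normalization of [h j]. *)
  exists (fun i => if i == j then t * Lpnorm p (g j) else a i).
  apply/funext => s; rewrite lincombS eqxx.
  have -> : lincomb h (fun i => if i == j then t * Lpnorm p (g j) else a i) j s
      = lincomb h a j s.
    by apply: eq_bigr => i _; rewrite (ltn_eqF (ltn_ord i)).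
  rewrite -xa /h; field; rewrite gt_eqF//.
exists h; split=> //.
- by move=> j; rewrite LpnormZ// gtr0_norm ?invr_gt0// mulVf ?gt_eqF.
- move=> a m n /subnK <-; elim: (n - m)%N => // k ih.
  rewrite addSn; apply: le_trans ih _; set l := (k + m)%N.
  have [_ _ _ gmono _] := gP l.
  rewrite (_ : lincomb h a l.+1 = fun s => lincomb h a l s +
      (a l * (Lpnorm p (g l))^-1) * g l s); last first.
    by apply/funext => s; rewrite lincombS /h; ring.
  by apply: gmono => //; exact: Lp_lincomb.
move=> f lf e e0.
have step_Lp j x : step_space q j x -> Lp p x.
  by move=> /Scomb[a ->]; exact: Lp_lincomb.
have [_ af] := step_approx_Lp p1 q_dense step_Lp lf.
have [j [x [/Scomb[a ->] fx]]] := af _ e0.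
by exists j, a.
Qed.

Lemma exists_disjoint_atoms (R : realType) (p : R) : 1 < p ->
  exists w : nat -> R -> R,
  [/\ forall k, Lp p (w k), forall k, Lpnorm p (w k) = 1, forall k x, 0 <= w k x,
    forall k l x, k != l -> w k x * w l x = 0 &
    forall k x, w k x != 0 -> 0 < x <= 1].
Proof.
move=> p1; have p0 : 0 < p by exact: lt_trans p1.
(* The intervals []1/(k+2), 1/(k+1)]] are disjoint and fill ]0, 1]. *)
pose a k : R := k.+2%:R^-1; pose b k : R := k.+1%:R^-1.
have ab k : a k < b k by rewrite ltf_pV2 ?posrE ?ltr0n// ltr_nat.
have ba0 k : 0 < b k - a k by rewrite subr_gt0.
pose c k := (b k - a k)^-1 `^ p^-1.
have c0 k : 0 <= c k by exact: powR_ge0.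
exists (fun k x => c k * ioc_indic (a k) (b k) x); split.
- by move=> k; have [] := LpnormX_ioc p1 (c k) (ab k).
- move=> k; have [_] := LpnormX_ioc p1 (c k) (ab k).
  rewrite ger0_norm// /c -powRrM mulVf ?gt_eqF// powRr1 ?invr_ge0 ?(ltW (ba0 k))//.
  rewrite mulVf ?gt_eqF// => n1.
  apply/eqP; rewrite eq_le; apply/andP; split; apply: (powR_le_inv p0);
    by rewrite ?Lpnorm_ge0 ?n1 ?powR1.
- by move=> k x; rewrite mulr_ge0// /ioc_indic.
- move=> k l x; wlog : k l / (k < l)%N.
    move=> H; rewrite neq_ltn => /orP[] kl; last rewrite mulrC.
      by apply: H => //; rewrite neq_ltn kl.
    by apply: H => //; rewrite neq_ltn kl.
  move=> kl _; have bl : b l <= a k by rewrite lef_pV2 ?posrE ?ltr0n// ler_nat.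
  rewrite /ioc_indic; have [ax|] := ltP (a k) x; last by rewrite !(mulr0, mul0r).
  by rewrite [x <= b l]leNgt (le_lt_trans bl ax) andbF !mulr0.
move=> k x; rewrite /ioc_indic; have [ax|] := ltP (a k) x; last by rewrite mulr0 eqxx.
have [xb _|] := leP x (b k); last by rewrite mulr0 eqxx.
by rewrite (lt_trans _ ax) ?invr_gt0// (le_trans xb)// invf_le1// ler1n.
Qed.

Lemma gap_shiftD (R : realType) (l : R) (f g : R -> R) x :
  gap_shift (fun s => l * f s + g s) x = l * gap_shift f x + gap_shift g x.
Proof.
by rewrite /gap_shift; case: ifP => // _; case: ifP => // _; rewrite mulr0 addr0.
Qed.

Lemma gap_shift_lincomb (R : realType) (g : nat -> R -> R) a n :
  lincomb (fun j => gap_shift (g j)) a n = gap_shift (lincomb g a n).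
Proof.
apply/funext => x; rewrite /lincomb /gap_shift; case: ifP => // _; case: ifP => // _.
by rewrite big1// => i _; rewrite mulr0.
Qed.

Lemma sum_half_le1 (R : realType) J : \sum_(j < J) (2 ^+ j.+1)^-1 <= 1 :> R.
Proof.
suff -> : \sum_(j < J) (2 ^+ j.+1)^-1 = 1 - (2 ^+ J)^-1 :> R.
  by rewrite gerBl invr_ge0 exprn_ge0.
elim: J => [|J ih]; first by rewrite big_ord0 expr0 invr1 subrr.
rewrite big_ord_recr/= ih exprS; field.
by rewrite expf_neq0.
Qed.

Theorem theorem3p3 (R : realType) (p : R) (hp : 1 < p) :
  exists z : nat -> R -> R,
    schauder_basic p z /\
    (forall j, {ae @lebesgue_measure R, forall x, 0 <= z j x}) /\
    Lp_embeds_into_span p z.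
Proof.
have [g [g_Lp g_norm g_mono g_dense]] := exists_haar_system hp.
have [w [w_Lp w_norm w_ge0 w_disj w_supp]] := exists_disjoint_atoms hp.
(* Row sums of at least [2^(j+1)] keep the sum of the inverses at most 1. *)
have /choice[nn /choice[A /choice[L AP]]] := fun j => exists_block_matrix hp (2 ^+ j.+1).
have L_ge j : 2 ^+ j.+1 <= L j by case: (AP j) => _ [].
pose H j := gap_shift (g j).
pose Hp j x := Num.max (H j x) 0; pose Hm j x := Num.max (- H j x) 0.
(* Coding the triple by a natural number assigns distinct atoms to distinct triples. *)
pose E (b : bool) (j i : nat) := w (pickle (b, (j, i))).
have H_Lp j : Lp p (H j) by have [] := Lp_gap_shift hp (g_Lp j).
have mH j : measurable_fun setT (H j) by case: (H_Lp j).
have Hp_Lp j : Lp p (Hp j).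
  apply: (Lp_le hp _ (H_Lp j)) => [|x]; first exact: measurable_funrpos.
  by rewrite ger0_norm ?le_max ?lexx ?orbT// ge_max ler_norm normr_ge0.
have Hm_le j x : `|Hm j x| <= `|H j x|.
  by rewrite ger0_norm ?le_max ?lexx ?orbT// ge_max -normrN ler_norm normr_ge0.
have mHm j : measurable_fun setT (Hm j) by exact: measurable_funrneg.
have H_norm j : Lpnorm p (H j) = 1.
  by have [_ ->] := Lp_gap_shift hp (g_Lp j).
have H_off b j i l x : E b j i x != 0 -> H l x = 0.
  move=> /w_supp/andP[x0 x1]; rewrite /H /gap_shift leNgt x0/= ifF//.
  by apply/negbTE; rewrite -leNgt.
have [z [z_basic z_ge0 z_span]] : exists z : nat -> R -> R,
    [/\ schauder_basic p z, forall j x, 0 <= z j x &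
    forall a n, exists m b, lincomb z b m = lincomb H a n].
  apply: (@exists_positive_basic_sequence R p hp H Hp Hm E _ _ _ _ _ _ _ _ _ _ _ _ nn A L).
  - exact: H_Lp.
  - exact: Hp_Lp.
  - by move=> j; exact: (Lp_le hp (mHm j) (H_Lp j) (Hm_le j)).
  - move=> j x; rewrite /Hp /Hm; have [x0|x0] := leP (H j x) 0.
      have Nx : 0 <= - H j x by rewrite oppr_ge0.
      by rewrite (max_idPl Nx) sub0r opprK.
    have Nx : - H j x <= 0 by rewrite oppr_le0 ltW.
    by rewrite (max_idPr Nx) subr0.
  - exact: H_norm.
  - by move=> j; rewrite -(H_norm j); exact: (Lpnorm_le hp (mHm j) (H_Lp j) (Hm_le j)).
  - move=> a m n mn; rewrite !gap_shift_lincomb.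
    have [_ ->] := Lp_gap_shift hp (Lp_lincomb hp g_Lp a m).
    by have [_ ->] := Lp_gap_shift hp (Lp_lincomb hp g_Lp a n); exact: g_mono.
  - by move=> b j i; exact: w_Lp.
  - by move=> b j i; exact: w_norm.
  - move=> b j i b' j' i' x h ne; have : E b j i x * E b' j' i' x = 0.
      apply: w_disj; rewrite (inj_eq (pcan_inj pickleK)) !xpair_eqE.
      by rewrite !negb_and eq_sym (eq_sym j) (eq_sym i).
    by move/eqP; rewrite mulf_eq0 (negbTE h) => /eqP.
  - by move=> b j i l x /H_off; rewrite /Hp => ->; rewrite maxxx.
  - by move=> b j i l x /H_off; rewrite /Hm => ->; rewrite oppr0 maxxx.
  - by move=> j; case: (AP j).
  - by move=> j; apply: le_trans (L_ge j); rewrite exprn_ege1// ler1n.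
  - move=> J; apply: le_trans (sum_half_le1 R J); apply: ler_sum => j _.
    by rewrite lef_pV2 ?posrE ?exprn_gt0//; case: (AP j) => _ [].
  - by move=> j; case: (AP j) => _ _ _ [].
  - by move=> j; case: (AP j) => _ _ _ [].
  - by move=> j; case: (AP j).
  - by move=> j; case: (AP j).
  - by move=> j x; rewrite le_max lexx orbT.
  - by move=> j x; rewrite le_max lexx orbT.
  - by move=> b j i x; exact: w_ge0.
exists z; split=> //; split; first by move=> j; exact: aeW.
(* The embedding is the isometric shift itself: it maps combinations of the Haar system to
   combinations of the [H j], which are combinations of the [z j]. *)
exists (@gap_shift R), 1, 1; do 2!(split; first exact: ltr01); split; [|split].
- move=> f lf; split; first by have [] := Lp_gap_shift hp lf.
  move=> e e0; have [n [a fa]] := g_dense f lf e e0.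
  have [m [b zb]] := z_span a n; exists m, b.
  rewrite zb (_ : _ \- _ = gap_shift (fun s => f s - lincomb g a n s)).
    by have [_ ->] := Lp_gap_shift hp (LpB hp lf (Lp_lincomb hp g_Lp a n)).
  apply/funext => x /=; rewrite gap_shift_lincomb addrC -mulN1r -gap_shiftD.
  by congr (gap_shift _ x); apply/funext => s; rewrite mulN1r addrC.
- move=> l f g' _ _; rewrite (_ : _ \- _ = fun=> 0) ?Lpnorm0//.
  by apply/funext => x /=; rewrite gap_shiftD subrr.
- by move=> f lf; have [_ ->] := Lp_gap_shift hp lf; rewrite !mul1r.
Qed.
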